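(* Suppose $\mathcal X\subset\mathbb R^d$ is a bounded subset with finite diameter $D=\sup_{\boldsymbol x,\boldsymbol x'\in\mathcal X}\|\boldsymbol x-\boldsymbol x'\|$. Assume that the loss function is $M$-Lipschitz continuous in $\boldsymbol x$, i.e., there exists a constant $M>0$ such that $$|\ell(\boldsymbol x,\boldsymbol\xi)-\ell(\boldsymbol x',\boldsymbol\xi)|\le M\|\boldsymbol x-\boldsymbol x'\|\qquad\forall\boldsymbol x,\boldsymbol x'\in\mathcal X,\ \forall\boldsymbol\xi\in\Xi.$$ Fix a tolerance level $\eta>0$ and $\delta\in(0,1)$. Then, with probability at least $1-\delta$, for all $\boldsymbol x\in\mathcal X$, $$\mathbb E_{\boldsymbol\gamma}[\ell(\boldsymbol x,\tilde{\boldsymbol\xi})]\le\hat{\mathbb E}_{\boldsymbol\gamma}[\ell(\boldsymbol x,\tilde{\boldsymbol\xi})]+\sqrt{\frac{\mathbb V_{\boldsymbol\gamma}[\ell(\boldsymbol x,\tilde{\boldsymbol\xi})]}{nh_n^pg(\boldsymbol\gamma)(1+o(1))}\log\left(\frac{|\mathcal X_\eta|}{\delta}\right)}+M\eta\left(1+\sqrt{\frac{\log\left(\frac{|\mathcal X_\eta|}{\delta}\right)}{nh_n^pg(\boldsymbol\gamma)(1+o(1))}}\right),$$ where $|\mathcal X_\eta|=O(1)(D/\eta)^d$.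
   Context: Let $(\tilde{\boldsymbol\gamma},\tilde{\boldsymbol\xi})$ be a random vector in $\mathbb R^p\times\mathbb R^q$ with joint density $f(\boldsymbol\gamma,\boldsymbol\xi)$, and let $f_{\tilde{\boldsymbol\gamma}}$ be the marginal density of $\tilde{\boldsymbol\gamma}$ (the side information). The historical data $(\boldsymbol\gamma^1,\boldsymbol\xi^1),\dots,(\boldsymbol\gamma^n,\boldsymbol\xi^n)$ are i.i.d. copies of $(\tilde{\boldsymbol\gamma},\tilde{\boldsymbol\xi})$. A side information vector $\boldsymbol\gamma\in\mathbb R^p$ is fixed. $\mathcal X\subseteq\mathbb R^d$ is the feasible set and $\ell(\boldsymbol x,\boldsymbol\xi)$ the loss function. Write $\mathbb E_{\boldsymbol\gamma}[\cdot]=\mathbb E[\cdot\mid\tilde{\boldsymbol\gamma}=\boldsymbol\gamma]$ and $\mathbb V_{\boldsymbol\gamma}[\cdot]=\mathbb V[\cdot\mid\tilde{\boldsymbol\gamma}=\boldsymbol\gamma]$ for the conditional expectation and variance. The kernel is $\mathcal K(\boldsymbol\theta)=\frac1Z\exp(-\|\boldsymbol\theta\|_2)$ with $Z=\int_{\mathbb R^p}\exp(-\|\boldsymbol\theta\|_2)\,d\boldsymbol\theta$, and $h=h_n>0$ is the bandwidth. The Nadaraya-Watson estimator is $$\hat{\mathbb E}_{\boldsymbol\gamma}[\ell(\boldsymbol x,\tilde{\boldsymbol\xi})]=\frac{\sum_{i=1}^n\mathcal K\left(\frac{\boldsymbol\gamma-\boldsymbol\gamma^i}{h_n}\right)\ell(\boldsymbol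 x,\boldsymbol\xi^i)}{\sum_{i=1}^n\mathcal K\left(\frac{\boldsymbol\gamma-\boldsymbol\gamma^i}{h_n}\right)}.$$ The scaled marginal density is $g(\boldsymbol\gamma)=f_{\tilde{\boldsymbol\gamma}}(\boldsymbol\gamma)/\big(2\int_{\mathbb R^p}\mathcal K^2(\boldsymbol\theta)\,d\boldsymbol\theta\big)$. Standing assumptions: (A1) the support $\Xi$ of $\tilde{\boldsymbol\xi}$ is compact and $\ell(\boldsymbol x,\boldsymbol\xi)\in[0,1]$ for all $\boldsymbol x\in\mathcal X$, $\boldsymbol\xi\in\Xi$; (A2) $f(\boldsymbol\gamma,\boldsymbol\xi)$ is twice differentiable with continuous and bounded partial derivatives, and $f_{\tilde{\boldsymbol\gamma}}$ is non-zero at the given $\boldsymbol\gamma$; (A3) $\lim_{n\to\infty}h_n=0$ and $\lim_{n\to\infty}nh_n^p=\infty$. The symbol $o(1)$ denotes a quantity converging to $0$ as $n\to\infty$. $\mathcal X_\eta\subset\mathcal X$ denotes a finite set of points such that for every $\boldsymbol x\in\mathcal X$ there is $\boldsymbol x'\in\mathcal X_\eta$ with $\|\boldsymbol x-\boldsymbol x'\|\le\eta$, chosen with cardinality $|\mathcal X_\eta|=O(1)(D/\eta)^d$.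
   Formalization: The cardinality bound |X_η| = O(1)(D/η)^d is stated only for η ≤ D, since for η much larger than D (for example X a single point, D = 0) it fails because |X_η| ≥ 1. *)

(* Defs.v *)
From HB Require Import structures.
From mathcomp Require Import all_boot all_order all_algebra finmap.
From mathcomp Require Import all_classical all_reals all_analysis.

Set Implicit Arguments.
Unset Strict Implicit.
Unset Printing Implicit Defensive.

Import Order.TTheory GRing.Theory Num.Theory.
Import numFieldNormedType.Exports.

Local Open Scope classical_set_scope.
Local Open Scope ring_scope.

(* The sigma-algebra on matrices generated by the entries; on 'rV[R]_n this is
   the Borel sigma-algebra of R^n (the library only has it on n.-tuple). *)

Definition measure_matrix_display : measure_display -> measure_display.
Proof. exact. Qed.

Section measurable_matrix.
Context {d : measure_display} {T : measurableType d} (m n : nat).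

Definition entry_cylinders : set (set 'M[T]_(m, n)) :=
  \bigcup_(k in [set: 'I_m * 'I_n])
    preimage_set_system setT (fun M : 'M[T]_(m, n) => M k.1 k.2) measurable.

Let matrix_set0 : <<s entry_cylinders >> set0.
Proof. exact: sigma_algebra0. Qed.

Let matrix_setC A : <<s entry_cylinders >> A -> <<s entry_cylinders >> (~` A).
Proof. exact: sigma_algebraC. Qed.

Let matrix_bigcup (F : (set 'M[T]_(m, n))^nat) :
  (forall i, <<s entry_cylinders >> (F i)) ->
  <<s entry_cylinders >> (\bigcup_i F i).
Proof. exact: sigma_algebra_bigcup. Qed.

HB.instance Definition _ := @isMeasurable.Build (measure_matrix_display d)
  'M[T]_(m, n) <<s entry_cylinders >> matrix_set0 matrix_setC matrix_bigcup.

End measurable_matrix.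

Lemma measurable_entry (d : measure_display) (T : measurableType d) (m n : nat)
    (i : 'I_m) (j : 'I_n) :
  measurable_fun [set: 'M[T]_(m, n)] (fun M : 'M[T]_(m, n) => M i j).
Proof.
move=> _ Y mY; rewrite setTI; apply: sub_sigma_algebra => /=.
by exists (i, j) => //; exists Y => //; rewrite setTI.
Qed.

Lemma measurable_fun_mxP (d d' : measure_display) (T : measurableType d)
    (T' : measurableType d') (m n : nat) (f : T' -> 'M[T]_(m, n)) :
  (forall i j, measurable_fun [set: T'] (fun x => f x i j)) ->
  measurable_fun [set: T'] f.
Proof.
move=> mf; apply: (@measurability _ _ _ _ _ _ (@entry_cylinders _ T m n)) => //.
move=> _ [_ [[i j] _ [Y mY <-]] <-] /=.
by rewrite !setTI; have := mf i j measurableT Y mY; rewrite setTI.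
Qed.

Section lebesgue_rV.
Context {R : realType}.

Definition rV_cons (n : nat) (z : measurableTypeR R * 'rV[R]_n) : 'rV[R]_n.+1 :=
  row_mx (const_mx z.1 : 'rV[R]_1) z.2.

Definition rV_uncons (n : nat) (v : 'rV[R]_n.+1) : measurableTypeR R * 'rV[R]_n :=
  (v ord0 ord0, rsubmx (v : 'rV[R]_(1 + n))).

Lemma rV_uncons_consK (n : nat) : cancel (@rV_cons n) (@rV_uncons n).
Proof.
case=> x v; rewrite /rV_cons /rV_uncons /=; congr (_, _).
  by rewrite mxE; case: splitP => //= k _; rewrite mxE.
by rewrite row_mxKr.
Qed.

Lemma measurable_rV_cons (n : nat) : measurable_fun setT (@rV_cons n).
Proof.
apply: measurable_fun_mxP => i j; rewrite /rV_cons.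
under eq_fun do rewrite mxE.
case: splitP => k jk.
- by under eq_fun do rewrite mxE; exact: measurable_fst.
- apply: (measurableT_comp (@measurable_entry _ _ _ _ i k)).
  exact: measurable_snd.
Qed.

Section lebesgue_rVS.
Context (n : nat) (mu : {sigma_finite_measure set 'rV[R]_n -> \bar R}).

Definition lebesgue_rVS (A : set 'rV[R]_n.+1) : \bar R :=
  ((@lebesgue_measure R) \x mu)%E (@rV_cons n @^-1` A).

Let m_preimage A : measurable A -> measurable (@rV_cons n @^-1` A).
Proof.
by move=> mA; rewrite -[X in measurable X]setTI; exact: measurable_rV_cons.
Qed.

Let lebesgue_rVS0 : lebesgue_rVS set0 = 0%E.
Proof. by rewrite /lebesgue_rVS preimage_set0 measure0. Qed.

Let lebesgue_rVS_ge0 A : (0 <= lebesgue_rVS A)%E.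
Proof. exact: measure_ge0. Qed.

Let lebesgue_rVS_sigma_additive : semi_sigma_additive lebesgue_rVS.
Proof.
move=> F mF tF mUF; rewrite /lebesgue_rVS preimage_bigcup.
apply: measure_semi_sigma_additive.
- by move=> k; exact: m_preimage.
- apply/trivIsetP => /= i j _ _ ij; rewrite -preimage_setI.
  by move/trivIsetP : tF => /(_ _ _ _ _ ij) ->//; rewrite preimage_set0.
- by rewrite -preimage_bigcup; exact: m_preimage.
Qed.

HB.instance Definition _ := isMeasure.Build _ _ _ lebesgue_rVS
  lebesgue_rVS0 lebesgue_rVS_ge0 lebesgue_rVS_sigma_additive.

Let measurable_rV_uncons : measurable_fun setT (@rV_uncons n).
Proof.
apply/measurable_fun_pairP; split => /=.
  exact: measurable_entry.
apply: measurable_fun_mxP => i j /=.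
under eq_fun do rewrite mxE.
exact: measurable_entry.
Qed.

Let lebesgue_rVS_sigma_finite : sigma_finite setT lebesgue_rVS.
Proof.
have /sigma_finiteP[F [TF ndF Foo]] := sigma_finiteT (@lebesgue_measure R).
have /sigma_finiteP[G [TG ndG Goo]] := sigma_finiteT mu.
exists (fun k => @rV_uncons n @^-1` (F k `*` G k)).
  rewrite -preimage_bigcup -[LHS](preimage_setT (@rV_uncons n)); congr (_ @^-1` _).
  rewrite -setXTT TF TG predeqE => -[x y]; split.
    move=> [/= [k _ Fkx] [l _ Gly]]; exists (maxn k l) => //; split.
    - by move: x Fkx; exact/subsetPset/ndF/leq_maxl.
    - by move: y Gly; exact/subsetPset/ndG/leq_maxr.
  by move=> [k _ []/= ? ?]; split; exists k.
move=> k; have [mF Fk] := Foo k; have [mG Gk] := Goo k; split.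
  rewrite -[X in measurable X]setTI; apply: measurable_rV_uncons => //.
  exact: measurableX.
rewrite /lebesgue_rVS -comp_preimage (_ : _ \o _ = id) ?preimage_id.
  by rewrite product_measure1E// lte_mul_pinfty// ge0_fin_numE.
by apply/funext => z /=; rewrite rV_uncons_consK.
Qed.

HB.instance Definition _ := Measure_isSigmaFinite.Build _ _ _ lebesgue_rVS
  lebesgue_rVS_sigma_finite.

End lebesgue_rVS.

(* The n-dimensional Lebesgue measure, as the n-fold product of the
   one-dimensional one; lebesgue_rV_rect gives its value on rectangles. *)
Fixpoint lebesgue_rV (n : nat) : {sigma_finite_measure set 'rV[R]_n -> \bar R} :=
  match n with
  | 0 => \d_(0 : 'rV[R]_0)
  | n'.+1 => lebesgue_rVS (lebesgue_rV n')
  end.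

Lemma measurable_rect (n : nat) (A : 'I_n -> set (measurableTypeR R)) :
  (forall i, measurable (A i)) ->
  measurable [set v : 'rV[R]_n | forall i, A i (v ord0 i)].
Proof.
move=> mA; rewrite (_ : mkset _ =
    \bigcap_(i in [set: 'I_n]) ((fun v : 'rV[R]_n => v ord0 i) @^-1` A i)).
  apply: fin_bigcap_measurable => // i _.
  by have := @measurable_entry _ R 1 n ord0 i measurableT _ (mA i); rewrite setTI.
by apply/seteqP; split => v /= Av i; [move=> _|]; exact: Av.
Qed.

Lemma lebesgue_rV_rect (n : nat) (A : 'I_n -> set (measurableTypeR R)) :
  (forall i, measurable (A i)) ->
  lebesgue_rV n [set v | forall i, A i (v ord0 i)] =
  (\prod_(i < n) lebesgue_measure (A i))%E.
Proof.
elim: n A => [|n IHn] A mA.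
  by rewrite big_ord0 /= diracE mem_set//= => -[].
rewrite big_ord_recl -IHn//= /lebesgue_rVS -product_measure1E//.
- congr (_ _); apply/seteqP; split => -[x v] /=.
  + move=> Av; split => [|i].
      by have := Av ord0; rewrite /rV_cons mxE; case: splitP => //= k _; rewrite mxE.
    have := Av (lift ord0 i); rewrite /rV_cons mxE; case: splitP => [[[]]//|k /=].
    by rewrite /bump/= => -[] /val_inj ->.
  + move=> [Ax Av] i; rewrite /rV_cons mxE; case: splitP => k ik.
      rewrite mxE (_ : i = ord0)//; apply/val_inj => /=.
      by rewrite ik; case: k {ik} => -[].
    by rewrite (_ : i = lift ord0 k)//; exact/val_inj.
- exact: (@measurable_rect n (fun i => A (lift ord0 i))).
Qed.

End lebesgue_rV.

(* The library norm of 'rV[R]_n is the maximum norm. *)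
Definition norm2 {R : realType} {n : nat} (v : 'rV[R]_n) : R :=
  Num.sqrt (\sum_(i < n) v ord0 i ^+ 2).

Definition diameter {R : realType} {d : nat} (X : set 'rV[R]_d) : R :=
  sup [set norm2 (z.1 - z.2) | z in X `*` X].

Definition eta_net {R : realType} {d : nat} (X : set 'rV[R]_d) (eta : R)
    (N : {fset 'rV[R]_d}) : Prop :=
  [set` N] `<=` X /\
  forall x, X x -> exists2 x', x' \in N & norm2 (x - x') <= eta.

Section kernel.
Context {R : realType} {p : nat}.

Definition kernel_mass : R := \int[lebesgue_rV p]_t expR (- norm2 t).

Definition kernel (t : 'rV[R]_p) : R := kernel_mass^-1 * expR (- norm2 t).

Definition nadaraya_watson {q : nat} (gammas : nat -> 'rV[R]_p)
    (xis : nat -> 'rV[R]_q) (n : nat) (h : R) (gamma : 'rV[R]_p)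
    (phi : 'rV[R]_q -> R) : R :=
  (\sum_(i < n) kernel (h^-1 *: (gamma - gammas i)) * phi (xis i)) /
  (\sum_(i < n) kernel (h^-1 *: (gamma - gammas i))).

End kernel.

Section density.
Context {R : realType} {p q : nat}.
Implicit Type f : 'rV[R]_p * 'rV[R]_q -> R.

Definition marginal f (gamma : 'rV[R]_p) : R :=
  \int[lebesgue_rV q]_xi f (gamma, xi).

(* E[phi(xi) | gamma] and V[phi(xi) | gamma] at a point gamma of positive
   marginal density, for the conditional density f (gamma, _) / marginal f gamma *)
Definition cond_expectation f (gamma : 'rV[R]_p) (phi : 'rV[R]_q -> R) : R :=
  \int[lebesgue_rV q]_xi (phi xi * (f (gamma, xi) / marginal f gamma)).

Definition cond_variance f (gamma : 'rV[R]_p) (phi : 'rV[R]_q -> R) : R :=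
  cond_expectation f gamma
    (fun xi => (phi xi - cond_expectation f gamma phi) ^+ 2).

Definition scaled_marginal f (gamma : 'rV[R]_p) : R :=
  marginal f gamma / (2 * \int[lebesgue_rV p]_t (kernel t ^+ 2)).

Definition coord_dir (k : 'I_p + 'I_q) : 'rV[R]_p * 'rV[R]_q :=
  match k with
  | inl i => (delta_mx ord0 i, 0)
  | inr j => (0, delta_mx ord0 j)
  end.

Definition continuous_bounded f : Prop :=
  continuous f /\ exists B : R, forall z, `|f z| <= B.

(* f is twice differentiable, and its partial derivatives of orders 1 and 2 are
   continuous and bounded *)
Definition twice_diff_bounded f : Prop :=
  (forall z, differentiable f z) /\
  forall k, [/\ forall z, differentiable ('D_(coord_dir k) f) z,
    continuous_bounded ('D_(coord_dir k) f) &
    forall l, continuous_bounded ('D_(coord_dir l) ('D_(coord_dir k) f))].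

End density.

Section random_vectors.
Context {R : realType} {disp : measure_display} {T : measurableType disp}.
Context (P : probability T R).

Definition joint_density {p q : nat} (Z : {RV P >-> ('rV[R]_p * 'rV[R]_q)%type})
    (f : 'rV[R]_p * 'rV[R]_q -> R) : Prop :=
  [/\ measurable_fun setT f, forall z, 0 <= f z &
    forall A, measurable A ->
      distribution P Z A =
      (\int[lebesgue_rV p \x lebesgue_rV q]_(z in A) (f z)%:E)%E].

Definition mutually_independent {disp' : measure_display}
    {T' : measurableType disp'} (Z : nat -> {RV P >-> T'}) : Prop :=
  forall (J : {fset nat}) (A : nat -> set T'), (forall i, measurable (A i)) ->
    P (\bigcap_(i in [set` J]) (Z i @^-1` A i)) =
    (\prod_(i <- J) P (Z i @^-1` A i))%E.

Definition iid_copies {disp' : measure_display} {T' : measurableType disp'}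
    (Z0 : {RV P >-> T'}) (Z : nat -> {RV P >-> T'}) : Prop :=
  (forall i A, measurable A -> distribution P (Z i) A = distribution P Z0 A) /\
  mutually_independent Z.

(* topological support of the law of Y *)
Definition support_of {q : nat} (Y : T -> 'rV[R]_q) : set 'rV[R]_q :=
  [set y | forall e : R, 0 < e -> (0 < P (Y @^-1` ball y e))%E].

(* E is not required to be measurable: it contains a measurable event of
   probability at least a *)
Definition with_probability_at_least (a : R) (E : set T) : Prop :=
  exists A, [/\ measurable A, (a%:E <= P A)%E & A `<=` E].

End random_vectors.

(* Main.v *)
(* Everything but [n] is fixed, so the claim is asymptotic and the term
   [M * eta] alone dominates the estimation error for large [n]: it suffices
   that the Nadaraya-Watson estimator is weakly consistent, uniformly on [X].
   Then [o1 n = 0] works for large [n], and for the finitely many other [n] one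
   takes [1 + o1 n] so small that [M * eta * sqrt (L / r) = 1], which beats the
   trivial bound [E <= 1].

   Uniformity follows from consistency on a finite [eta / 3]-net and the
   Lipschitz condition.  At a fixed point, writing [k_i = exp (- |gamma -
   gamma_i| / h)] and [c] for the conditional expectation of the loss [phi], the
   estimator is at least [c - eps] unless
   [\sum_i k_i * (c - eps - phi xi_i) > 0], and Chebyshev's inequality applies
   to this sum of i.i.d. variables.  If [I] is the integral of the weight over a
   small ball around [gamma], the summands have mean at most [- const * I] and
   second moment at most [const * I], because [f (u, _)] is uniformly close to
   [f (gamma, _)] on that ball while the weight is at most
   [exp (- r / h) = o (h ^ p)] outside of it.  As [I >= const * h ^ p], the
   probability is [O (1 / (n * h ^ p))]. *)

Require Import Defs.
From HB Require Import structures.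
From mathcomp Require Import all_boot all_order all_algebra finmap.
From mathcomp Require Import all_classical all_reals all_analysis.
From mathcomp Require Import measurable_realfun ring lra.

Set Implicit Arguments.
Unset Strict Implicit.
Unset Printing Implicit Defensive.

Import Order.TTheory GRing.Theory Num.Theory.
Import numFieldNormedType.Exports.

Local Open Scope classical_set_scope.
Local Open Scope ring_scope.

(** * Euclidean norm and nets *)

Section norm2.
Context {R : realType} {n : nat}.
Implicit Types v : 'rV[R]_n.

Lemma norm2_ge0 v : 0 <= norm2 v.
Proof. exact: sqrtr_ge0. Qed.

Lemma ler_coord_norm2 v i : `|v ord0 i| <= norm2 v.
Proof.
rewrite -sqrtr_sqr ler_wsqrtr// (bigD1 i)//= lerDl.
by apply: sumr_ge0 => j _; exact: sqr_ge0.
Qed.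

(** The sharp factor is the square root of [n]. The cruder [n] comes from [n <= n ^ 2] and keeps all
    the constants below free of roots. *)
Lemma norm2_le_coord v (c : R) : 0 <= c ->
  (forall i, `|v ord0 i| <= c) -> norm2 v <= n%:R * c.
Proof.
move=> c0 vc; rewrite -[leRHS]ger0_norm ?mulr_ge0// -sqrtr_sqr ler_wsqrtr//.
apply: (@le_trans _ _ (\sum_(i < n) c ^+ 2)).
  by apply: ler_sum => i _; rewrite -real_normK ?num_real// lerXn2r ?nnegrE.
rewrite sumr_const card_ord -[leLHS]mulr_natl exprMn ler_wpM2r ?sqr_ge0//.
by rewrite -natrX ler_nat; case: n => // k; rewrite leq_pmulr.
Qed.

Lemma ler_coord_norm v i : `|v ord0 i| <= `|v|.
Proof.
rewrite -[leRHS]/(mx_norm v) mx_normrE.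
by apply: (le_bigmax _ (fun ij => `|v ij.1 ij.2|) (ord0, i)).
Qed.

End norm2.

Section nets.
Context {R : realType} {d : nat}.
Implicit Types X : set 'rV[R]_d.

(** A supremum bounds its set only if that set is bounded above. Boundedness of [X], which refers to
    the maximum norm, is carried over to [norm2] coordinatewise. *)
Lemma norm2_le_diameter X (x y : 'rV[R]_d) :
  bounded_set X -> X x -> X y -> norm2 (x - y) <= diameter X.
Proof.
move=> [B0 [_ /(_ (B0 + 1)) XB]] Xx Xy.
have {}XB z : X z -> `|z| <= B0 + 1 by move=> Xz; apply: XB; rewrite ?ltrDl.
set B := B0 + 1 in XB.
apply: ub_le_sup; last by exists (x, y).
exists (d%:R * (B + B)) => _ [[u v] [/= Xu Xv] <-].
apply: norm2_le_coord => [|i].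
  by rewrite addr_ge0//; apply: le_trans (XB _ Xu).
rewrite !mxE (le_trans (ler_normB _ _))// lerD//.
  exact: le_trans (ler_coord_norm _ _) (XB _ Xu).
exact: le_trans (ler_coord_norm _ _) (XB _ Xv).
Qed.

(* One point of [X] is picked in each occupied cell of a cubic grid of mesh
   [eta / d.+1], on a cube of side [2 * diameter X] around a point of [X]. *)
Lemma eta_net_grid X (eta : R) : bounded_set X -> 0 < eta ->
  exists2 N : {fset 'rV[R]_d}, eta_net X eta N &
  (#|` N| <= (Num.trunc (2 * diameter X * d.+1%:R / eta)).+1 ^ d)%N.
Proof.
move=> bX eta0; have [->|/set0P[x0 Xx0]] := eqVneq X set0.
  by exists fset0; [split => // x; rewrite /mkset inE|rewrite cardfs0].
set D := diameter X; set m := Num.trunc _.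
have D0 : 0 <= D by exact: le_trans (norm2_ge0 _) (norm2_le_diameter bX Xx0 Xx0).
(* Two points of a cell differ by less than [s] in each coordinate, hence by at most [d * s <= eta]
   in norm. Taking [d.+1] also covers dimension [0]. *)
pose s : R := eta / d.+1%:R.
have s0 : 0 < s by rewrite divr_gt0.
pose pos (x : 'rV[R]_d) i : R := (x ord0 i - x0 ord0 i + D) / s.
have pos_itv x i : X x -> 0 <= pos x i <= 2 * D * d.+1%:R / eta.
  move=> Xx; have := le_trans (ler_coord_norm2 (x - x0) i)
    (norm2_le_diameter bX Xx Xx0).
  rewrite !mxE ler_norml -/D => /andP[lo hi]; apply/andP; split.
    by rewrite divr_ge0 ?(ltW s0)//; lra.
  rewrite /pos /s invf_div mulrA ler_pM2r ?invr_gt0// ler_pM2r//; lra.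
pose cell x : {ffun 'I_d -> 'I_m.+1} := [ffun i => inord (Num.trunc (pos x i))].
(* The default [x0] lies in [X], so [g c] does too when the cell is empty. *)
pose g c := xget x0 [set x | X x /\ cell x = c].
have gX c : X (g c) by rewrite /g; case: xgetP => [y -> []|].
exists [fset x in [seq g c | c : {ffun 'I_d -> 'I_m.+1}]]%fset; last first.
  rewrite card_fseq (leq_trans (size_undup _))// size_map -cardE card_ffun.
  by rewrite !card_ord.
split=> [x|x Xx]; first by rewrite /= inE => /mapP[c _ ->].
exists (g (cell x)).
  by rewrite inE; apply/mapP; exists (cell x) => //; rewrite mem_enum.
have [Xg cg] : X (g (cell x)) /\ cell (g (cell x)) = cell x.
  rewrite {1 2}/g; case: xgetP => [y -> //|] /(_ x); case; split=> //.
apply: (@le_trans _ _ (d%:R * s)); last first.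
  by rewrite /s mulrCA ler_piMr ?(ltW eta0)// ler_pdivrMr// mul1r ler_nat.
apply: norm2_le_coord => [|i]; first exact: ltW.
(* Cell indices stay in range, so [inord] does not send any of them to its default value. *)
have tr y : X y -> (Num.trunc (pos y i) < m.+1)%N.
  move=> Xy; have /andP[p0 pm] := pos_itv y i Xy.
  by rewrite ltnS; exact: le_truncn.
have e : Num.trunc (pos x i) = Num.trunc (pos (g (cell x)) i).
  move/ffunP : cg => /(_ i); rewrite !ffunE => /(congr1 val) /=.
  by rewrite !inordK ?tr.
have /andP[px0 _] := pos_itv x i Xx; have /andP[pg0 _] := pos_itv _ i Xg.
have /andP[a1 a2] := truncn_itv px0; have /andP[b1 b2] := truncn_itv pg0.
rewrite -e in b1 b2; rewrite -[leRHS]mul1r -ler_pdivrMr//.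
rewrite -{1}(gtr0_norm s0) -normf_div !mxE.
have -> : (x ord0 i - g (cell x) ord0 i) / s = pos x i - pos (g (cell x)) i.
  by rewrite /pos; ring.
rewrite -natr1 in a2 b2; rewrite ler_norml; lra.
Qed.

(** As [diameter X / eta >= 1], the additive [1] in the number of cells per axis is absorbed into a
    multiple of this ratio. *)
Lemma eta_net_card X (eta : R) : bounded_set X -> 0 < eta ->
  eta <= diameter X ->
  exists2 N : {fset 'rV[R]_d}, eta_net X eta N &
    (#|` N|)%:R <= (2 * d.+1%:R + 1) ^+ d * (diameter X / eta) ^+ d.
Proof.
move=> bX eta0 etaD; have [N XN NC] := eta_net_grid bX eta0.
exists N => //; rewrite -exprMn.
move: NC; rewrite -(ler_nat R) => /le_trans; apply.
rewrite natrX lerXn2r ?nnegrE// ?mulr_ge0// ?invr_ge0 ?(ltW eta0)//.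
  exact: le_trans (ltW eta0) etaD.
have q1 : 1 <= diameter X / eta by rewrite ler_pdivlMr// mul1r.
set q := diameter X / eta in q1 *.
have -> : 2 * diameter X * d.+1%:R / eta = 2 * d.+1%:R * q by rewrite /q; ring.
have x0 : 0 <= 2 * d.+1%:R * q by apply: mulr_ge0; [exact: mulr_ge0|exact: le_trans q1].
rewrite [leRHS]mulrDl mul1r -[leLHS]natr1 lerD//.
by have /andP[] := truncn_itv x0.
Qed.

End nets.

(** * Lebesgue measure on row vectors *)

Section rV_measure.
Context {R : realType} {n : nat}.
Implicit Types (v : 'rV[R]_n) (U : set 'rV[R]_n).

(** Balls of the maximum norm are cubes. Positivity of [r] matters in dimension [0], where the
    right-hand side is everything. *)
Lemma ball_rVE v (r : R) : 0 < r ->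
  ball v r = [set u : 'rV[R]_n | forall i, ball (v ord0 i) r (u ord0 i)].
Proof.
move=> r0; apply/seteqP; split=> u /=; first by case=> _ vu i; exact: vu.
by move=> vu; split=> // i j; rewrite ord1.
Qed.

Lemma measurable_ball_rV v (r : R) : measurable (ball v r).
Proof.
have [r0|r0] := ltP 0 r; last first.
  rewrite (_ : ball v r = set0)//; apply/seteqP; split=> // u [].
  by rewrite ltNge r0.
rewrite ball_rVE//.
by apply: (@measurable_rect R n (fun i => ball (v ord0 i) r)) => i; exact: measurable_ball.
Qed.

Lemma lebesgue_ball_rV v (r : R) : 0 < r ->
  lebesgue_rV n (ball v r) = ((r *+ 2) ^+ n)%:E.
Proof.
move=> r0; rewrite ball_rVE//.
rewrite (@lebesgue_rV_rect R n (fun i => ball (v ord0 i) r)); last first.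
  by move=> i; exact: measurable_ball.
under eq_bigr do rewrite lebesgue_measure_ball ?(ltW r0)//.
by rewrite prodEFin prodr_const card_ord.
Qed.

Definition rat_ball (cr : 'rV[rat]_n * rat) : set 'rV[R]_n :=
  ball (map_mx ratr cr.1 : 'rV[R]_n) (ratr cr.2 : R).

(** A countable base of the topology. It makes open sets measurable for the sigma-algebra of the
    entries, and later covers the complement of a support by countably many null balls. *)
Lemma open_rat_ball U : open U ->
  U = \bigcup_(cr in [set cr | rat_ball cr `<=` U]) rat_ball cr.
Proof.
move=> oU; apply/seteqP; split=> [u Uu|u [cr /= crU]]; last exact: crU.
have /nbhs_ballP[e /= e0 eU] : nbhs u U by rewrite nbhsE; exists U.
have e20 : 0 < e / 2 by rewrite divr_gt0.
(* The center is taken within [r < e / 2] of [u], so the rational ball contains [u] and stays inside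
   the ball of radius [e]. *)
have [r /=] := rat_in_itvoo e20; rewrite in_itv/= => /andP[r0 re].
have c_ i : {c : rat | u ord0 i - ratr r < ratr c < u ord0 i + ratr r}.
  apply: cid; have h : u ord0 i - ratr r < u ord0 i + ratr r by lra.
  by have [c] := rat_in_itvoo h; rewrite in_itv/=; exists c.
pose c := \row_i sval (c_ i).
have cu i : ball ((map_mx ratr c : 'rV[R]_n) ord0 i) (ratr r) (u ord0 i).
  rewrite /ball/= !mxE; case: (c_ i) => q /= /andP[q1 q2].
  by rewrite ltr_distl; lra.
exists (c, r); last by rewrite /rat_ball /= ball_rVE.
move=> w; rewrite /rat_ball/= ball_rVE// => cw; apply: eU.
rewrite ball_rVE// => i.
apply: (@le_ball _ _ _ (ratr r + ratr r)); first lra.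
by apply: (@ball_triangle _ _ ((map_mx ratr c : 'rV[R]_n) ord0 i)); [exact: ball_sym|].
Qed.

Lemma measurable_open_rV U : open U -> measurable U.
Proof.
move=> /open_rat_ball ->.
rewrite bigcup_mkcond; apply: countable_bigcupT_measurable => // cr.
by case: ifPn => // _; exact: measurable_ball_rV.
Qed.

Lemma measurable_closed_rV U : closed U -> measurable U.
Proof.
rewrite -openC => /measurable_open_rV/measurableC.
by rewrite setCK.
Qed.

Lemma compact_rV_closed U : compact U -> closed U.
Proof. by apply: compact_closed; exact: norm_hausdorff. Qed.

Lemma compact_rV_fin_measure U : compact U -> (lebesgue_rV n U < +oo)%E.
Proof.
move=> cU; have /compact_bounded[B [_ /(_ (B + 1))]] := cU.
rewrite ltrDl ltr01 => /(_ isT) UB.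
(* The absolute value keeps the radius positive even if the bound [B] is negative, as may happen for
   an empty set. *)
pose r := `|B| + 2.
apply: (@le_lt_trans _ _ (lebesgue_rV n (ball (0 : 'rV[R]_n) r))).
  apply: le_measure; rewrite ?inE.
  - by apply: measurable_closed_rV; exact: compact_rV_closed.
  - exact: measurable_ball_rV.
  - move=> u Uu; rewrite ball_rVE ?ltr_wpDl// => i; rewrite /ball/= mxE sub0r normrN.
    rewrite (le_lt_trans (ler_coord_norm u i))// (le_lt_trans (UB _ Uu))//.
    by rewrite /r; have := ler_norm B; lra.
by rewrite lebesgue_ball_rV ?ltry// ltr_wpDl.
Qed.

End rV_measure.

(** * Integrals of exponentials of the norm, and the constants of the kernel *)

Lemma measurable_norm2 (R : realType) (n : nat) :
  measurable_fun setT (@norm2 R n).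
Proof.
have ms : measurable_fun setT (@Num.sqrt R).
  by apply: continuous_measurable_fun; exact: sqrt_continuous.
apply: (measurableT_comp ms).
apply: measurable_sum => i; apply: measurable_funX.
exact: measurable_entry.
Qed.

Lemma measurable_expRN d (T : measurableType d) (R : realType) (c : R)
    (g : T -> R) : measurable_fun setT g ->
  measurable_fun setT (fun t => (expR (- (c * g t)))%:E).
Proof.
move=> mg; apply/measurable_EFinP; apply: measurableT_comp.
  exact: measurable_expR.
by apply: measurableT_comp => //; exact: measurable_funM.
Qed.

Section kernel_mass.
Context {R : realType}.

(** By symmetry this is twice the integral over the half-line, where the integrand is [c^-1] times
    the exponential density. *)
Lemma integral_expR_abs (c : R) : 0 < c ->
  (\int[lebesgue_measure]_x (expR (- (c * `|x|)))%:E < +oo)%E.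
Proof.
move=> c0; rewrite ge0_symfun_integralT//=.
- rewrite (_ : [set x | (0 <= x)%R] = `[0, +oo[%classic); last first.
    by apply/seteqP; split=> x; rewrite /= in_itv/= andbT.
  apply: lte_mul_pinfty => //.
  have -> : (\int[lebesgue_measure]_(x in `[0%R, +oo[%classic) (expR (- (c * `|x|)))%:E =
      \int[lebesgue_measure]_(x in `[0%R, +oo[%classic) ((c^-1)%:E * (exponential_pdf c x)%:E))%E.
    apply: eq_integral => x; rewrite inE/= in_itv/= andbT => x0.
    by rewrite exponential_pdfE// -EFinM mulrA mulVf ?gt_eqF// mul1r ger0_norm// mulNr.
  rewrite ge0_integralZl//; last 3 first.
  - apply/measurable_EFinP/measurable_funTS; exact: measurable_exponential_pdf.
  - by move=> x _; rewrite lee_fin exponential_pdf_ge0// ltW.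
  - by rewrite lee_fin invr_ge0 ltW.
  apply: lte_mul_pinfty; rewrite ?lee_fin ?invr_ge0 ?(ltW c0)//.
  rewrite (le_lt_trans _ (ltry 1))// -(integral_exponential_pdf c0).
  apply: ge0_subset_integral => //.
    apply/measurable_EFinP; exact: measurable_exponential_pdf.
  by move=> x _; rewrite lee_fin exponential_pdf_ge0// ltW.
- move=> x; apply: continuous_comp; last exact: continuous_expR.
  apply: continuousN; apply: continuousM; first exact: cvg_cst.
  exact: norm_continuous.
- by move=> x /=; rewrite normrN.
Qed.

Lemma ge0_integral_lebesgue_rVS (n : nat) (F : 'rV[R]_n.+1 -> \bar R) :
  measurable_fun setT F -> (forall v, 0 <= F v)%E ->
  (\int[lebesgue_rV n.+1]_v F v =
   \int[lebesgue_measure]_x \int[lebesgue_rV n]_v F (rV_cons (x, v)))%E.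
Proof.
move=> mF F0.
have -> : (\int[lebesgue_rV n.+1]_v F v =
    \int[pushforward (lebesgue_measure \x lebesgue_rV n) (@rV_cons R n)]_v F v)%E.
  by apply: eq_measure_integral => [|mc A mA _ //]; exact: measurable_rV_cons.
rewrite ge0_integral_pushforward//; last exact: measurable_rV_cons.
rewrite preimage_setT fubini_tonelli1//=.
by apply: measurableT_comp => //; exact: measurable_rV_cons.
Qed.

Lemma measurable_expR_norm1 (n : nat) (c : R) :
  measurable_fun setT
    (fun v : 'rV[R]_n => (expR (- (c * \sum_(i < n) `|v ord0 i|)))%:E).
Proof.
apply: measurable_expRN; apply: measurable_sum => i; apply: measurableT_comp => //.
exact: measurable_entry.
Qed.

(** For the sum of the absolute coordinates the exponential factors, so Tonelli splits off one
    coordinate at a time. *)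
Lemma integral_expR_norm1 (n : nat) (c : R) : 0 < c ->
  (\int[lebesgue_rV n]_v (expR (- (c * \sum_(i < n) `|v ord0 i|)))%:E < +oo)%E.
Proof.
move=> c0; elim: n => [|n IHn].
  rewrite [X in (X < _)%E]integral_dirac//; last exact: measurable_expR_norm1.
  by rewrite diracT mul1e ltry.
rewrite ge0_integral_lebesgue_rVS; last 2 first.
- exact: measurable_expR_norm1.
- by move=> v; rewrite lee_fin expR_ge0.
set I := (X in (X < _)%E) in IHn.
have I0 : (0 <= I)%E by apply: integral_ge0 => v _; rewrite lee_fin expR_ge0.
have S x v : \sum_(i < n.+1) `|(@rV_cons R n (x, v)) ord0 i| =
    `|x| + \sum_(i < n) `|v ord0 i|.
  rewrite big_ord_recl; congr (`|_| + _).
    by rewrite /rV_cons mxE; case: splitP => //= k _; rewrite mxE.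
  apply: eq_bigr => i _; congr (`|_|); rewrite /rV_cons mxE.
  by case: splitP => [[[]]//|k /=]; rewrite /bump/= => -[] /val_inj ->.
have E x : (\int[lebesgue_rV n]_v
    (expR (- (c * \sum_(i < n.+1) `|(rV_cons (x, v)) ord0 i|)))%:E =
    (expR (- (c * `|x|)))%:E * I)%E.
  rewrite -ge0_integralZl ?lee_fin ?expR_ge0//; last first.
  - exact: measurable_expR_norm1.
  apply: eq_integral => v _; by rewrite -EFinM -expRD -opprD -mulrDr S.
under eq_integral do rewrite E.
rewrite ge0_integralZr//; last first.
- exact: measurable_expRN.
rewrite -(fineK (x := I)) ?ge0_fin_numE// muleC.
by apply: lte_mul_pinfty; rewrite ?lee_fin ?fine_ge0//; exact: integral_expR_abs.
Qed.

(** Positivity comes from the unit cube, where the integrand is at least [expR (- (c * n))].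
    Finiteness comes from comparison with the sum of the absolute coordinates, which is at most
    [n.+1 * norm2 v]. *)
Lemma integral_expR_norm2 (n : nat) (c : R) : 0 < c ->
  (0 < \int[lebesgue_rV n]_v (expR (- (c * norm2 v)))%:E < +oo)%E.
Proof.
move=> c0.
have me : measurable_fun setT (fun v : 'rV[R]_n => (expR (- (c * norm2 v)))%:E).
  by apply: measurable_expRN; exact: measurable_norm2.
pose B := ball (0 : 'rV[R]_n) 1.
have mB : measurable B by exact: measurable_ball_rV.
have e0 v : (0 <= (expR (- (c * @norm2 R n v)))%:E)%E by rewrite lee_fin expR_ge0.
apply/andP; split.
  have h1 : (0 < \int[lebesgue_rV n]_(v in B)
      (expR (- (c * n%:R)))%:E)%E.
    rewrite integral_cst//.
    by rewrite /B [X in (_ * X)%E]lebesgue_ball_rV// mule_gt0// lte_fin ?expR_gt0 ?exprn_gt0.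
  apply: (lt_le_trans h1).
  have h2 : (\int[lebesgue_rV n]_(v in B)
      (expR (- (c * norm2 v)))%:E <=
      \int[lebesgue_rV n]_v (expR (- (c * norm2 v)))%:E)%E.
    exact: ge0_subset_integral.
  apply: (le_trans _ h2); apply: ge0_le_integral => //.
  - exact: measurable_funTS.
  - move=> v; rewrite /B ball_rVE// => bv.
    rewrite lee_fin ler_expR lerN2 ler_pM2l// -[leRHS]mulr1.
    apply: norm2_le_coord => // i.
    by have := bv i; rewrite /ball/= mxE sub0r normrN => /ltW.
have c1 : 0 < c / n.+1%:R by rewrite divr_gt0.
apply: (le_lt_trans _ (integral_expR_norm1 n c1)).
apply: ge0_le_integral => //.
- exact: measurable_expR_norm1.
move=> v _; rewrite lee_fin ler_expR lerN2 -mulrA ler_pM2l//.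
rewrite mulrC ler_pdivrMr//.
apply: (@le_trans _ _ (\sum_(i < n) norm2 v)).
  by apply: ler_sum => i _; exact: ler_coord_norm2.
by rewrite sumr_const card_ord -[leLHS]mulr_natr ler_wpM2l ?norm2_ge0// ler_nat.
Qed.

(** Finiteness matters as much as positivity here: the real-valued integral would be [0] if the
    integral were infinite. *)
Lemma kernel_mass_gt0 (p : nat) : 0 < kernel_mass (R := R) (p := p).
Proof.
have := integral_expR_norm2 p (@ltr01 R).
under eq_integral do rewrite mul1r.
by move=> /fine_gt0.
Qed.

Lemma kernelE (p : nat) (t : 'rV[R]_p) :
  Defs.kernel t = (kernel_mass (p := p))^-1 * expR (- norm2 t).
Proof. by []. Qed.

Lemma integral_kernel_sqr_gt0 (p : nat) :
  0 < \int[lebesgue_rV p]_t (Defs.kernel t ^+ 2) :> R.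
Proof.
have /andP[I0 Ioo] := integral_expR_norm2 p (@ltr0Sn R 1).
rewrite /Rintegral.
have -> : (\int[lebesgue_rV p]_t (Defs.kernel t ^+ 2)%:E =
    ((kernel_mass (R := R) (p := p))^-1 ^+ 2)%:E * \int[lebesgue_rV p]_t (expR (- (2 * norm2 t)))%:E)%E.
  rewrite -ge0_integralZl ?lee_fin ?sqr_ge0//; last first.
    by apply: measurable_expRN; exact: measurable_norm2.
  by apply: eq_integral => t _; rewrite -EFinM kernelE exprMn -expRM_natl mulrN.
apply: fine_gt0; apply/andP; split.
  by rewrite mule_gt0// lte_fin exprn_gt0// invr_gt0 kernel_mass_gt0.
by apply: lte_mul_pinfty => //; rewrite lee_fin sqr_ge0.
Qed.

End kernel_mass.

(** * Sums of i.i.d. variables *)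

Section bounded_measurable.
Context {d : measure_display} {T : measurableType d} {R : realType}.
Implicit Types f g : T -> R.

(** This class is closed under sums and products and integrable for every finite measure, which
    settles the integrability side conditions for the sample sums. *)
Definition bounded_measurable f :=
  measurable_fun setT f /\ exists B : R, forall t, `|f t| <= B.

Lemma bounded_measurable_cst (c : R) : bounded_measurable (fun=> c).
Proof. by split; [exact: measurable_cst|exists `|c|]. Qed.

Lemma bounded_measurableD f g : bounded_measurable f -> bounded_measurable g ->
  bounded_measurable (fun t => f t + g t).
Proof.
move=> [mf [B fB]] [mg [C gC]]; split; first exact: measurable_funD.
by exists (B + C) => t; rewrite (le_trans (ler_normD _ _))// lerD.
Qed.

Lemma bounded_measurableM f g : bounded_measurable f -> bounded_measurable g ->
  bounded_measurable (fun t => f t * g t).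
Proof.
move=> [mf [B fB]] [mg [C gC]]; split; first exact: measurable_funM.
by exists (B * C) => t; rewrite normrM ler_pM.
Qed.

Lemma bounded_measurable_sum (I : Type) (s : seq I) (F : I -> T -> R) :
  (forall i, bounded_measurable (F i)) ->
  bounded_measurable (fun t => \sum_(i <- s) F i t).
Proof.
move=> bF; elim: s => [|i s IH].
  under eq_fun do rewrite big_nil; exact: bounded_measurable_cst.
under eq_fun do rewrite big_cons; exact: bounded_measurableD.
Qed.

Section integrals.
Variable mu : {finite_measure set T -> \bar R}.

Lemma bounded_measurable_integrable f : bounded_measurable f ->
  mu.-integrable setT (EFin \o f).
Proof.
move=> [mf [B fB]]; apply: measurable_bounded_integrable => //.
  by rewrite -ge0_fin_numE ?fin_num_measure.
by exists B; split; [exact: num_real|move=> x Bx t _; exact: le_trans (ltW Bx)].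
Qed.

Lemma Rintegral_sum (I : Type) (s : seq I) (F : I -> T -> R) :
  (forall i, bounded_measurable (F i)) ->
  \int[mu]_t (\sum_(i <- s) F i t) = \sum_(i <- s) \int[mu]_t F i t.
Proof.
move=> bF; elim: s => [|i s IH].
  by under eq_Rintegral do rewrite big_nil; rewrite big_nil Rintegral_cst ?mul0r.
under eq_Rintegral do rewrite big_cons.
rewrite big_cons -IH RintegralD//; apply: bounded_measurable_integrable => //.
exact: bounded_measurable_sum.
Qed.

End integrals.
End bounded_measurable.

Lemma bounded_measurable_comp d d' (T : measurableType d) (T' : measurableType d')
    (R : realType) (Z : T' -> T) (f : T -> R) :
  measurable_fun setT Z -> bounded_measurable f ->
  bounded_measurable (fun t => f (Z t)).
Proof.
by move=> mZ [mf [B fB]]; split; [exact: measurableT_comp|exists B].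
Qed.

Section iid.
Context {R : realType} {d : measure_display} {T : measurableType d}.
Variable P : probability T R.

(* Chebyshev's inequality: the sum has mean [a *+ n] and variance at most
   [b *+ n]. *)
Lemma sum_gt0_probability (Y : nat -> T -> R) (a b : R) (n : nat) :
  (forall i, bounded_measurable (Y i)) ->
  (forall i, \int[P]_w Y i w = a) ->
  (forall i, \int[P]_w (Y i w * Y i w) <= b) ->
  (forall i j, i != j -> \int[P]_w (Y i w * Y j w) = a ^+ 2) ->
  a < 0 -> (0 < n)%N ->
  (P [set w | (0 < \sum_(i < n) Y i w)%R] <= (b / (n%:R * a ^+ 2))%:E)%E.
Proof.
move=> bY Ya Yb Yij a0 n0.
pose Z i w := Y i w + - a.
have bZ i : bounded_measurable (Z i).
  by apply: bounded_measurableD => //; exact: bounded_measurable_cst.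
pose S w := \sum_(i < n) Z i w.
have bS : bounded_measurable S by exact: bounded_measurable_sum.
have bSS : bounded_measurable (fun w => S w * S w) by exact: bounded_measurableM.
have ZE i j : \int[P]_w (Z i w * Z j w) = \int[P]_w (Y i w * Y j w) - a ^+ 2.
  rewrite (@eq_Rintegral _ _ _ _ _ (fun w => Y i w * Y j w + (- a * Y i w +
     (- a * Y j w + a ^+ 2)))); last by move=> w _; rewrite /Z; ring.
  have bi k : P.-integrable setT (EFin \o (fun w => - a * Y k w)).
    apply: bounded_measurable_integrable; apply: bounded_measurableM => //.
    exact: bounded_measurable_cst.
  rewrite !RintegralD//; do ?[apply: bounded_measurable_integrable;
    do ?[apply: bounded_measurableD|apply: bounded_measurableM|exact: bounded_measurable_cst|exact: bY]].
  do 2 (rewrite RintegralZl//; last exact: bounded_measurable_integrable).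
  rewrite !Ya Rintegral_cst//= probability_setT/= mulr1; ring.
have SSE : \int[P]_w (S w * S w) <= n%:R * b.
  rewrite (@eq_Rintegral _ _ _ _ _ (fun w => \sum_(i < n) \sum_(j < n) Z i w * Z j w)); last first.
    by move=> w _; rewrite /S mulr_suml; apply: eq_bigr => i _; rewrite mulr_sumr.
  rewrite Rintegral_sum; last first.
    by move=> i; apply: bounded_measurable_sum => j; exact: bounded_measurableM.
  apply: (@le_trans _ _ (\sum_(i < n) b)); last first.
    by rewrite sumr_const card_ord -[leLHS]mulr_natl.
  (* The covariances off the diagonal vanish, and a diagonal one is at most [b] once [- a ^+ 2] is
     dropped. *)
  apply: ler_sum => i _; rewrite Rintegral_sum; last first.
    by move=> j; exact: bounded_measurableM.
  rewrite (bigD1 i)//= big1 ?addr0; last first.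
    by move=> j ji; rewrite ZE Yij ?subrr// eq_sym.
  by rewrite ZE (le_trans _ (Yb i))// gerBl sqr_ge0.
set A := [set w | _].
have mA : measurable A.
  have [mS _] : bounded_measurable (fun w => \sum_(i < n) Y i w).
    exact: bounded_measurable_sum.
  by rewrite -[A]setTI; apply: measurable_fun_ltr => //; exact: measurable_cst.
(* A positive sum of the [Y i] exceeds its negative mean, so the centered sum [S] exceeds
   [- (n * a) > 0]. Markov's inequality for [S ^ 2] then finishes. *)
have AS w : A w -> (n%:R * a) ^+ 2 <= S w * S w.
  rewrite /A /= => Yw; rewrite -expr2 -sqrrN lerXn2r ?nnegrE//.
  - by rewrite oppr_ge0 mulr_ge0_le0// ltW.
  - rewrite /S /Z big_split/= sumr_const card_ord addr_ge0//; first exact: ltW.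
    by rewrite mulrn_wge0// oppr_ge0 ltW.
  - by rewrite /S /Z big_split/= sumr_const card_ord -[X in _ + X]mulr_natl mulrN lerDr ltW.
have nR0 : n%:R != 0 :> R by rewrite pnatr_eq0 -lt0n.
have an0 : a != 0 by rewrite lt_eqF.
have na0 : 0 < (n%:R * a) ^+ 2 by rewrite exprn_even_gt0//= mulf_neq0.
have : (((n%:R * a) ^+ 2)%:E * P A <= (n%:R * b)%:E)%E.
  apply: (@le_trans _ _ (\int[P]_w (S w * S w)%:E)%E).
    rewrite -integral_cst//.
    apply: (@le_trans _ _ (\int[P]_(w in A) (S w * S w)%:E)%E).
      apply: ge0_le_integral => //.
      - by move=> w _; rewrite lee_fin sqr_ge0.
      - by apply/measurable_EFinP; apply: measurable_funTS; case: bSS.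
    apply: ge0_subset_integral => //.
    - by apply/measurable_EFinP; case: bSS.
    - by move=> w _; rewrite lee_fin -expr2 sqr_ge0.
  rewrite -(@fineK _ (\int[P]_w (S w * S w)%:E)%E) ?lee_fin//.
  by apply: integrable_fin_num => //; exact: (bounded_measurable_integrable P bSS).
rewrite -lee_pdivlMl// => /le_trans; apply.
rewrite -EFinM lee_fin le_eqVlt; apply/orP; left; apply/eqP.
by field; rewrite an0.
Qed.

Section pairs.
Context {d' : measure_display} {T' : measurableType d'}.
Variables (Z0 : {RV P >-> T'}) (Z : nat -> {RV P >-> T'}).
Hypothesis iidZ : iid_copies Z0 Z.

Lemma iid_Rintegral (F : T' -> R) i : bounded_measurable F ->
  \int[P]_w F (Z i w) = \int[distribution P Z0]_z F z.
Proof.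
move=> bF; have [mF _] := bF.
have bFZ := bounded_measurable_comp (measurable_funPT (Z i)) bF.
rewrite /Rintegral; congr fine.
rewrite -[LHS](@integral_distribution _ _ _ _ _ P (Z i) (EFin \o F)); last 2 first.
- exact/measurable_EFinP.
- exact: (bounded_measurable_integrable P bFZ).
by apply: eq_measure_integral => A mA _; exact: iidZ.1.
Qed.

(** Independence gives the law of [(Z i, Z j)] on rectangles, which identifies it with [mu \x mu].
    Fubini then factors the integral. *)
Lemma iid_RintegralM (F : T' -> R) i j : bounded_measurable F -> i != j ->
  \int[P]_w (F (Z i w) * F (Z j w)) = (\int[distribution P Z0]_z F z) ^+ 2.
Proof.
move=> bF ij; set mu := distribution P Z0.
pose W w := (Z i w, Z j w).
have mW : measurable_fun setT W by apply/measurable_fun_pairP; split.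
pose G (z : T' * T') := F z.1 * F z.2.
have bG : bounded_measurable G.
  by apply: bounded_measurableM; exact: bounded_measurable_comp.
have [mG _] := bG.
have bGW : bounded_measurable (G \o W).
  exact: bounded_measurable_comp mW bG.
have -> : \int[P]_w (F (Z i w) * F (Z j w)) = fine (\int[mu \x mu]_z (G z)%:E)%E.
  rewrite /Rintegral; congr fine.
  have -> : (\int[mu \x mu]_z (G z)%:E = \int[pushforward P W]_z (G z)%:E)%E.
    apply: eq_measure_integral => A mA _.
    apply: product_measure_unique => // B C mB mC.
    pose J := [fset i; j]%fset.
    (* Independence is stated for families indexed by all of [nat]; this one is [B] at [i] and [C]
       elsewhere, in particular at [j]. *)
    have mJ k : measurable (if k == i then B else C) by case: ifP.
    have := iidZ.2 J _ mJ.
    rewrite big_fsetU1 ?inE//= big_seq_fset1 eqxx eq_sym (negbTE ij).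
    rewrite -[P (Z i @^-1` B)]/(distribution P (Z i) B).
    rewrite -[P (Z j @^-1` C)]/(distribution P (Z j) C).
    rewrite !iidZ.1// => <-; congr (P _); apply/seteqP; split=> w /=.
      move=> [Bw Cw] k /fset2P[->|->]; first by rewrite eqxx.
      by rewrite eq_sym (negbTE ij).
    move=> BC; split.
      have := BC i; rewrite eqxx; apply; exact: fset21.
    have := BC j; rewrite eq_sym (negbTE ij); apply.
    exact: fset22.
  rewrite integral_pushforward//=.
  - exact/measurable_EFinP.
  - exact: (bounded_measurable_integrable P bGW).
rewrite -integral12_prod_meas1; last first.
  apply: measurable_bounded_integrable => //.
    have muT : mu setT = 1%E by exact: probability_setT.
    have mumu : (mu \x mu)%E (setT `*` setT) = 1%E.
      transitivity (mu setT * mu setT)%E; first exact: product_measure1E.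
      by rewrite muT mul1e.
    rewrite setXTT in mumu; apply: (@le_lt_trans _ _ 1%E); last exact: ltry.
    by rewrite -mumu.
  by have [_ [B GB]] := bG; exists B; split;
    [exact: num_real|move=> x Bx t _; exact: le_trans (ltW Bx)].
have iF := bounded_measurable_integrable mu bF.
rewrite expr2 -RintegralZr//; congr fine; apply: eq_integral => z _.
rewrite /fubini_F /G/= -(@RintegralZl _ _ _ mu _ F)// /Rintegral fineK//.
apply: integrable_fin_num => //.
apply: (bounded_measurable_integrable mu (f := fun y => F z * F y)).
apply: bounded_measurableM => //; exact: bounded_measurable_cst.
Qed.

End pairs.
End iid.

(** * Densities and supports *)

(** [f] and the Radon-Nikodym derivative of [nu] have the same integral over every measurable set,
    hence agree almost everywhere, and the change of variables for the derivative applies to [f]. *)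
Lemma integral_density d (T : measurableType d) (R : realType)
    (nu : {finite_measure set T -> \bar R})
    (mu : {sigma_finite_measure set T -> \bar R}) (f F : T -> R) :
  measurable_fun setT f ->
  (forall A, measurable A -> nu A = \int[mu]_(z in A) (f z)%:E)%E ->
  bounded_measurable F ->
  (\int[nu]_z (F z)%:E = \int[mu]_z (F z * f z)%:E)%E.
Proof.
move=> mf nuE bF.
have dom : nu `<< mu.
  apply/null_content_dominatesP => A mA muA0; rewrite nuE// null_set_integral//.
  by apply/measurable_EFinP; exact: measurable_funTS.
have iF := bounded_measurable_integrable nu bF.
rewrite -(Radon_Nikodym_change_of_variables dom)//.
have [mF _] := bF.
have domc : charge_of_finite_measure nu `<< mu by [].
have iRN := Radon_Nikodym_integrable domc.
apply: ae_eq_integral => //.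
- apply: emeasurable_funM; first exact/measurable_EFinP.
  by have /integrableP[] := iRN.
- by apply/measurable_EFinP; exact: measurable_funM.
- apply: (ae_eqe_mul2l (g := EFin \o f) (EFin \o F)).
  apply: integral_ae_eq => //; first exact/measurable_EFinP.
  by move=> A _ mA; rewrite -nuE// -(Radon_Nikodym_integral domc).
Qed.

Section support.
Context {R : realType} {d : measure_display} {T : measurableType d}.
Variable P : probability T R.

(** Each point off the support has a null ball around it, hence a null rational ball, and there are
    only countably many of these. *)
Lemma support_of_full {q : nat} (Y : T -> 'rV[R]_q) :
  measurable_fun setT Y -> P.-negligible (Y @^-1` (~` support_of P Y)).
Proof.
move=> mY.
have mYb cr : measurable (Y @^-1` rat_ball cr).
  by rewrite -[X in measurable X]setTI; apply: mY => //; exact: measurable_ball_rV.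
pose F k : set T := if (choice.unpickle k : option ('rV[rat]_q * rat)) is Some cr then
  if P (Y @^-1` rat_ball cr) == 0%E then Y @^-1` rat_ball cr else set0 else set0.
apply: (@negligibleS _ _ _ P (\bigcup_k F k)); last first.
  apply: negligible_bigcup => k; rewrite /F.
  case: choice.unpickle => [cr|]; last exact: negligible_set0.
  case: ifPn => [/eqP cr0|_]; last exact: negligible_set0.
  by exists (Y @^-1` rat_ball cr); split.
move=> w /=; rewrite /support_of /= => /existsNP[e /not_implyP[e0 /negP]].
rewrite lt0e negb_and negbK measure_ge0 orbF => /eqP Pe.
have oB : open (ball (Y w) e) by exact: ball_open.
have : ball (Y w) e (Y w) by exact: ballxx.
rewrite {1}(open_rat_ball oB) => -[cr /= crB crw].
exists (choice.pickle cr) => //; rewrite /F choice.pickleK.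
rewrite ifT// -measure_le0 -Pe.
apply: le_measure; rewrite ?inE//.
  by rewrite -[X in measurable X]setTI; apply: mY => //; exact: measurable_ball_rV.
by move=> u; exact: crB.
Qed.

End support.

Section density.
Context {R : realType} {p q : nat} {d : measure_display} {T : measurableType d}.
Variables (P : probability T R) (Z0 : {RV P >-> ('rV[R]_p * 'rV[R]_q)%type}).
Variable f : 'rV[R]_p * 'rV[R]_q -> R.
Hypothesis fZ0 : joint_density Z0 f.
Hypothesis cf : continuous f.
Let Xi := support_of P (fun w => (Z0 w).2).
Hypothesis cXi : compact Xi.

Let mf : measurable_fun setT f. Proof. by case: fZ0. Qed.
Let f0 z : 0 <= f z. Proof. by case: fZ0. Qed.
Let dZ0 A : measurable A -> (distribution P Z0 A =
  \int[lebesgue_rV p \x lebesgue_rV q]_(z in A) (f z)%:E)%E.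
Proof. by case: fZ0 => _ _; apply. Qed.

(** This holds at every point, not just almost everywhere: by continuity a positive value would
    persist on a product of balls whose second factor misses the closed set [Xi], and a null event
    would get positive mass. *)
Lemma density_off_support u xi : ~ Xi xi -> f (u, xi) = 0.
Proof.
move=> Nxi; apply/eqP; apply: contra_notT Nxi => f_neq0.
have fu0 : 0 < f (u, xi) by rewrite lt0r f_neq0 f0.
pose c := f (u, xi) / 2.
have c0 : 0 < c by rewrite divr_gt0.
apply: contrapT => Nxi.
have oN : open (~` Xi) by apply: closed_openC; exact: compact_rV_closed.
have n1 : nbhs (u, xi) [set z : 'rV[R]_p * 'rV[R]_q | ~ Xi z.2].
  exists (setT, ~` Xi); last by move=> z [].
  by split; [exact: filterT|exact: (open_nbhs_nbhs (conj oN Nxi))].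
have n2 : nbhs (u, xi) [set z | c < f z].
  have : nbhs (u, xi) (f @^-1` ball (f (u, xi)) c).
    exact: (cf (nbhsx_ballx (f (u, xi)) c c0)).
  apply: filterS => z.
  rewrite /preimage/= /ball/= distrC ltr_distl => /andP[+ _].
  by rewrite /c; lra.
have /nbhs_ballP[r /= r0 br] : nbhs (u, xi)
  ([set z : 'rV[R]_p * 'rV[R]_q | ~ Xi z.2] `&` [set z | c < f z]).
  exact: filterI.
pose B := ball u r `*` ball xi r.
have BE : B `<=` [set z | ~ Xi z.2] `&` [set z | c < f z].
  by move=> [y1 y2] yB; exact: (br (y1, y2) yB).
have mB : measurable B by apply: measurableX; exact: measurable_ball_rV.
have : (distribution P Z0 B <= 0)%E.
  have [N [mN PN NS]] := support_of_full P (measurableT_comp measurable_snd (measurable_funPT Z0)).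
  rewrite -PN -[leLHS]/(P (Z0 @^-1` B)); apply: le_measure; rewrite ?inE//.
    by rewrite -[X in measurable X]setTI; exact: measurable_funPT.
  by move=> w /BE[+ _]; exact: NS.
apply/negP; rewrite -ltNge dZ0//.
apply: (@lt_le_trans _ _ (\int[lebesgue_rV p \x lebesgue_rV q]_(z in B) c%:E)%E).
  have BE' := product_measure1E (lebesgue_rV p) (lebesgue_rV q)
    (measurable_ball_rV u r) (measurable_ball_rV xi r).
  have b0 k (v : 'rV[R]_k) : (0 < lebesgue_rV k (ball v r))%E.
    by rewrite lebesgue_ball_rV// lte_fin exprn_gt0// mulr2n addr_gt0.
  rewrite integral_cst// [X in (_ * X)%E]BE'.
  by apply: mule_gt0 => //; apply: mule_gt0; exact: b0.
apply: ge0_le_integral => //.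
- by move=> z _; rewrite lee_fin ltW.
- by apply/measurable_EFinP; exact: measurable_funTS.
- by move=> z /BE[_ /ltW]; rewrite lee_fin.
Qed.

(** Compactness makes the radius uniform over [xi] in the support. Off the support both values are
    [0]. *)
Lemma density_unif_continuous gamma (e : R) : 0 < e ->
  exists2 r : R, 0 < r & forall u xi, ball gamma r u ->
    `|f (u, xi) - f (gamma, xi)| <= e.
Proof.
move=> e0.
have e20 : 0 < e / 2 by rewrite divr_gt0.
have : nbhs gamma [set u | Xi `<=` [set xi | `|f (u, xi) - f (gamma, xi)| <= e]].
  apply: ((compact_near_coveringP Xi).1 cXi _ (nbhs gamma)
    (fun u xi => `|f (u, xi) - f (gamma, xi)| <= e)) => xi _.
  have : nbhs (gamma, xi) (f @^-1` ball (f (gamma, xi)) (e / 2)).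
    exact: (cf (nbhsx_ballx (f (gamma, xi)) _ e20)).
  move=> [[U V] /= [nU nV] UV]; exists (V, U) => //= -[x u] [/= Vx Uu].
  have := UV (u, x) (conj Uu Vx); have := UV (gamma, x) (conj (nbhs_singleton nU) Vx).
  rewrite /preimage/= /ball/= => h1 h2.
  rewrite -(subrKA (f (gamma, xi))) (le_trans (ler_normD _ _))//.
  by rewrite distrC; apply: ltW; rewrite (splitr e) ltrD.
move=> /nbhs_ballP[r /= r0 br]; exists r => // u xi gu.
have [Xixi|Nxi] := pselect (Xi xi); first exact: br gu _ Xixi.
by rewrite !density_off_support// subrr normr0 ltW.
Qed.

End density.

(* The library's sigma-finite structure on [m1 \x m2] is only inferred for
   sub-probabilities, hence the explicit hypothesis. *)
Lemma integral_density2 d1 d2 (T1 : measurableType d1) (T2 : measurableType d2)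
    (R : realType) (nu : {finite_measure set (T1 * T2)%type -> \bar R})
    (m1 : {sigma_finite_measure set T1 -> \bar R})
    (m2 : {sigma_finite_measure set T2 -> \bar R}) (f F : T1 * T2 -> R) :
  sigma_finite setT (m1 \x m2)%E ->
  measurable_fun setT f ->
  (forall A, measurable A -> nu A = \int[m1 \x m2]_(z in A) (f z)%:E)%E ->
  bounded_measurable F ->
  (\int[nu]_z (F z)%:E = \int[m1 \x m2]_z (F z * f z)%:E)%E.
Proof.
move=> smu mf nuE bF.
pose smuB := Measure_isSigmaFinite.Build _ _ _ (m1 \x m2)%E smu.
pose mu : {sigma_finite_measure set (T1 * T2)%type -> \bar R} :=
  HB.pack (m1 \x m2)%E smuB.
exact: (@integral_density _ _ _ nu mu f F mf nuE bF).
Qed.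

Lemma sigma_finite_lebesgue_rV2 (R : realType) (p q : nat) :
  sigma_finite setT (@lebesgue_rV R p \x @lebesgue_rV R q)%E.
Proof.
have in_ball n (v : 'rV[R]_n) (r : R) : `|v| < r -> ball (0 : 'rV[R]_n) r v.
  move=> vr; rewrite ball_rVE ?(le_lt_trans _ vr)// => i.
  by rewrite /ball/= mxE sub0r normrN (le_lt_trans (ler_coord_norm v i)).
pose B n k := ball (0 : 'rV[R]_n) k.+1%:R.
exists (fun k => B p k `*` B q k).
  apply/seteqP; split=> // -[u v] _.
  exists (Num.trunc (`|u| + `|v|)) => //.
  have lt := truncnS_gt (`|u| + `|v|).
  by split; apply: in_ball; apply: le_lt_trans lt; rewrite ?lerDl ?lerDr.
move=> k; have mB n : measurable (B n k) by exact: measurable_ball_rV.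
split; first by apply: measurableX; exact: mB.
apply: (@le_lt_trans _ _ (lebesgue_rV p (B p k) * lebesgue_rV q (B q k))%E).
  by rewrite le_eqVlt; apply/orP; left; apply/eqP; apply: product_measure1E; exact: mB.
have E n : lebesgue_rV n (B n k) = ((k.+1%:R *+ 2) ^+ n)%:E.
  exact: lebesgue_ball_rV.
by rewrite (E p) (E q) -EFinM ltry.
Qed.

(** * Expectations of weights concentrated near [gamma] *)

Lemma local_weight_integral (R : realType) (p : nat) (gamma : 'rV[R]_p) (r : R)
    (kap : 'rV[R]_p -> R) :
  0 < r -> measurable_fun setT kap -> (forall u, 0 <= kap u <= 1) ->
  (forall u, ~ ball gamma r u -> kap u = 0) ->
  (\int[lebesgue_rV p]_u (kap u)%:E = (\int[lebesgue_rV p]_u kap u)%:E)%E.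
Proof.
move=> r0 mk k01 kS; have k0 u : 0 <= kap u by case/andP: (k01 u).
rewrite /Rintegral fineK// ge0_fin_numE ?integral_ge0//; last first.
  by move=> u _; rewrite lee_fin.
apply: (@le_lt_trans _ _ (\int[lebesgue_rV p]_u (\1_(ball gamma r) u)%:E)%E).
  apply: ge0_le_integral => //.
  - by move=> u _; rewrite lee_fin.
  - exact/measurable_EFinP.
  - by apply/measurable_EFinP; apply: measurable_indic; exact: measurable_ball_rV.
  - move=> u _; rewrite lee_fin indicE.
    have [gu|Ngu] := pselect (ball gamma r u); last by rewrite kS.
    by rewrite mem_set//; case/andP: (k01 u).
rewrite integral_indic//; last exact: measurable_ball_rV.
by rewrite setIT [ltLHS]lebesgue_ball_rV// ltry.
Qed.

Section local_bounds.
Context {R : realType} {p q : nat} {d : measure_display} {T : measurableType d}.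
Variables (P : probability T R) (Z0 : {RV P >-> ('rV[R]_p * 'rV[R]_q)%type}).
Variable f : 'rV[R]_p * 'rV[R]_q -> R.
Hypothesis fZ0 : joint_density Z0 f.
Hypothesis cf : continuous f.
Let Xi := support_of P (fun w => (Z0 w).2).
Hypothesis cXi : compact Xi.

Let mf : measurable_fun setT f. Proof. by case: fZ0. Qed.
Let f0 z : 0 <= f z. Proof. by case: fZ0. Qed.
Let mXi : measurable Xi.
Proof. by apply: measurable_closed_rV; exact: compact_rV_closed. Qed.

Let mfu u : measurable_fun setT (fun xi => f (u, xi)).
Proof. exact: measurableT_comp (measurable_pair1 u). Qed.

Let V := fine (lebesgue_rV q Xi).

Let VE : lebesgue_rV q Xi = V%:E.
Proof.
rewrite /V fineK// ge0_fin_numE//; exact: compact_rV_fin_measure.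
Qed.

(** An infinite integral would have [fine] value [0], so a non-zero marginal forces the section of
    the density to be integrable. *)
Lemma marginalE gamma : marginal f gamma != 0 ->
  (\int[lebesgue_rV q]_xi (f (gamma, xi))%:E = (marginal f gamma)%:E)%E.
Proof.
rewrite /marginal /Rintegral; set I := (X in fine X) => I0.
rewrite fineK//.
have : (0 <= I)%E by apply: integral_ge0 => xi _; rewrite lee_fin.
by case: I I0 => //; rewrite /= eqxx.
Qed.

Lemma marginal_gt0 gamma : marginal f gamma != 0 -> 0 < marginal f gamma.
Proof.
move=> m0; rewrite lt0r m0/=; apply: Rintegral_ge0 => xi _; exact: f0.
Qed.

Section weight.
Variable phi : 'rV[R]_q -> R.
Hypothesis mphi : measurable_fun setT phi.
Hypothesis phi01 : forall xi, 0 <= phi xi <= 1.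

Let phi0 xi : 0 <= phi xi. Proof. by case/andP: (phi01 xi). Qed.

(** The unnormalized conditional mean of [phi] at [u], extended-valued so that Tonelli applies
    without integrability conditions. *)
Let H u := (\int[lebesgue_rV q]_xi (phi xi * f (u, xi))%:E)%E.

Let mH u : measurable_fun setT (fun xi => (phi xi * f (u, xi))%:E).
Proof. by apply/measurable_EFinP; exact: measurable_funM. Qed.

Let H0 u : (0 <= H u)%E.
Proof. by apply: integral_ge0 => xi _; rewrite lee_fin mulr_ge0. Qed.

Lemma integral_section gamma : marginal f gamma != 0 ->
  H gamma = (\int[lebesgue_rV q]_xi (phi xi * f (gamma, xi)))%:E.
Proof.
move=> m0; rewrite /Rintegral fineK// ge0_fin_numE; last exact: H0.
rewrite (@le_lt_trans _ _ (marginal f gamma)%:E) ?ltry// -marginalE//.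
apply: ge0_le_integral => //.
- by move=> xi _; rewrite lee_fin mulr_ge0.
- by apply/measurable_EFinP.
- by move=> xi _; rewrite lee_fin ler_piMl//; case/andP: (phi01 xi).
Qed.

(** The density vanishes off the compact support, so an error [e] in it costs at most [e] times the
    finite volume [V] of the support. *)
Let H_le u u' (e : R) : 0 <= e -> (forall xi, f (u, xi) <= f (u', xi) + e) ->
  (H u <= H u' + (e * V)%:E)%E.
Proof.
move=> e0 uu'.
have <- : (\int[lebesgue_rV q]_xi (e * \1_Xi xi)%:E = (e * V)%:E)%E.
  under eq_integral do rewrite EFinM.
  rewrite ge0_integralZl//.
    by rewrite integral_indic// EFinM setIT; congr (_ * _)%E; exact: VE.
  by apply/measurable_EFinP; exact: measurable_indic.
have mi : measurable_fun setT (fun xi : 'rV[R]_q => (e * \1_Xi xi)%:E).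
  by apply/measurable_EFinP; apply: measurable_funM => //; exact: measurable_indic.
rewrite -ge0_integralD//; do ?by move=> xi _; rewrite lee_fin mulr_ge0.
apply: ge0_le_integral => //.
- by move=> xi _; rewrite lee_fin mulr_ge0.
- exact: emeasurable_funD.
- move=> xi _; rewrite -EFinD lee_fin.
  have [Xixi|Nxi] := pselect (Xi xi).
    rewrite indicE mem_set// mulr1 (le_trans (ler_wpM2l (phi0 xi) (uu' xi)))//.
    by rewrite mulrDr lerD2l ler_piMl//; case/andP: (phi01 xi).
  by rewrite !(density_off_support fZ0 cf cXi) ?mulr0 ?add0r// mulr_ge0// indicE.
Qed.

Lemma integral_product_density (kap : 'rV[R]_p -> R) :
  measurable_fun setT kap -> (forall u, 0 <= kap u <= 1) ->
  (\int[distribution P Z0]_z (kap z.1 * phi z.2)%:E =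
   \int[lebesgue_rV p]_u ((kap u)%:E * H u))%E.
Proof.
move=> mk k01; case: fZ0 => _ _ dZ0.
have k0 u : 0 <= kap u by case/andP: (k01 u).
pose F (z : 'rV[R]_p * 'rV[R]_q) := kap z.1 * phi z.2.
have mF : measurable_fun setT F.
  by apply: measurable_funM; exact: measurableT_comp.
have bF : bounded_measurable F.
  split=> //; exists 1 => z; rewrite /F ger0_norm ?mulr_ge0// mulr_ile1//.
    by case/andP: (k01 z.1).
  by case/andP: (phi01 z.2).
have FE : (\int[distribution P Z0]_z (F z)%:E =
    \int[lebesgue_rV p \x lebesgue_rV q]_z (F z * f z)%:E)%E.
  exact: (integral_density2 (nu := distribution P Z0)
    (sigma_finite_lebesgue_rV2 R p q) mf dZ0 bF).
rewrite [LHS]FE /F.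
rewrite fubini_tonelli1//=; last 2 first.
- by apply/measurable_EFinP; exact: measurable_funM.
- by move=> z; rewrite lee_fin !mulr_ge0.
apply: eq_integral => u _; rewrite /fubini_F/= -ge0_integralZl//; last 2 first.
- by move=> xi _; rewrite lee_fin mulr_ge0.
- by rewrite lee_fin.
by apply: eq_integral => xi _; rewrite -EFinM mulrA.
Qed.

(** On the ball, [H u] is within [e * V] of [H gamma = G]; elsewhere [kap] vanishes. Integrating
    against [kap] gives both bounds. *)
Lemma local_bounds gamma (r e : R) (kap : 'rV[R]_p -> R) :
  marginal f gamma != 0 -> 0 < r -> 0 <= e ->
  (forall u xi, ball gamma r u -> `|f (u, xi) - f (gamma, xi)| <= e) ->
  measurable_fun setT kap -> (forall u, 0 <= kap u <= 1) ->
  (forall u, ~ ball gamma r u -> kap u = 0) ->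
  let I := \int[lebesgue_rV p]_u kap u in
  let G := \int[lebesgue_rV q]_xi (phi xi * f (gamma, xi)) in
  I * (G - e * V) <= \int[distribution P Z0]_z (kap z.1 * phi z.2) /\
  \int[distribution P Z0]_z (kap z.1 * phi z.2) <= I * (G + e * V).
Proof.
move=> m0 r0 e0 fe mk k01 kS I G.
have k0 u : 0 <= kap u by case/andP: (k01 u).
have mH' : measurable_fun setT H.
  apply: (measurable_fun_fubini_tonelli_F (m2 := lebesgue_rV q)
    (fun z : 'rV[R]_p * 'rV[R]_q => (phi z.2 * f z)%:E)).
    apply/measurable_EFinP; apply: measurable_funM => //.
    exact: measurableT_comp.
  by move=> z; rewrite lee_fin mulr_ge0.
have mkH : measurable_fun setT (fun u => (kap u)%:E * H u)%E.
  by apply: emeasurable_funM => //; exact/measurable_EFinP.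
have mkc (c : R) : measurable_fun setT (fun u => c%:E * (kap u)%:E)%E.
  by apply: emeasurable_funM => //; exact/measurable_EFinP.
have IE := local_weight_integral r0 mk k01 kS.
have V0 : 0 <= V by apply: fine_ge0.
have G0 : 0 <= G by apply: Rintegral_ge0 => xi _; rewrite mulr_ge0.
have I0 : 0 <= I by apply: Rintegral_ge0.
have up u : ball gamma r u -> (H u <= (G + e * V)%:E)%E.
  move=> gu; rewrite EFinD -integral_section//; apply: H_le => // xi.
  by have := fe u xi gu; rewrite ler_distl => /andP[].
have lo u : ball gamma r u -> ((G - e * V)%:E <= H u)%E.
  move=> gu; rewrite EFinB leeBlDr// -integral_section//; apply: H_le => // xi.
  by have := fe u xi gu; rewrite distrC ler_distl => /andP[].
have E1 : (\int[lebesgue_rV p]_u ((kap u)%:E * H u) <= (I * (G + e * V))%:E)%E.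
  rewrite mulrC EFinM -IE -ge0_integralZl//; last 3 first.
  - exact/measurable_EFinP.
  - by move=> u _; rewrite lee_fin.
  - by rewrite lee_fin addr_ge0// mulr_ge0.
  apply: ge0_le_integral => //.
  - by move=> u _; rewrite mule_ge0 ?lee_fin ?k0 ?H0//.
  - move=> u _; rewrite muleC; have [gu|Ngu] := pselect (ball gamma r u).
      by apply: lee_wpmul2r; [rewrite lee_fin|exact: up].
    by rewrite kS// !mule0.
have E2 : ((I * (G - e * V))%:E <= \int[lebesgue_rV p]_u ((kap u)%:E * H u))%E.
  (* A negative constant cannot be moved through the integral of non-negative functions, but then
     the bound is trivial. *)
  have [c0|c0] := leP (G - e * V) 0.
    apply: (@le_trans _ _ 0%E); last by apply: integral_ge0 => u _; rewrite mule_ge0 ?lee_fin ?k0 ?H0//.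
    by rewrite lee_fin mulr_ge0_le0.
  rewrite mulrC EFinM -IE -ge0_integralZl//; last 3 first.
  - exact/measurable_EFinP.
  - by move=> u _; rewrite lee_fin.
  - by rewrite lee_fin ltW.
  apply: ge0_le_integral => //.
  - by move=> u _; rewrite mule_ge0 ?lee_fin ?(ltW c0).
  - move=> u _; rewrite [leRHS]muleC; have [gu|Ngu] := pselect (ball gamma r u).
      by apply: lee_wpmul2r; [rewrite lee_fin|exact: lo].
    by rewrite kS// !mule0.
rewrite /Rintegral integral_product_density// -!lee_fin fineK; first by split.
rewrite ge0_fin_numE ?(le_lt_trans E1) ?ltry//.
by apply: integral_ge0 => u _; rewrite mule_ge0 ?lee_fin ?k0 ?H0//.
Qed.

End weight.
End local_bounds.

(** * Exponential weights *)

(** The inequality [1 + y <= expR y] at [y = x / k.+1], raised to the power [k.+1]. *)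
Lemma expRN_le_pow (R : realType) (k : nat) (x : R) : 0 < x ->
  expR (- x) <= (k.+1%:R / x) ^+ k.+1.
Proof.
move=> x0; have xk0 : 0 < x / k.+1%:R by rewrite divr_gt0.
rewrite -invf_div exprVn expRN lef_pV2 ?posrE ?expR_gt0 ?exprn_gt0//.
have -> : expR x = expR (x / k.+1%:R) ^+ k.+1.
  by rewrite -expRM_natl mulrC divfK.
rewrite lerXn2r ?nnegrE ?expR_ge0 ?(ltW xk0)//.
by apply: le_trans (expR_ge1Dx _); rewrite lerDr.
Qed.

Section exp_weight.
Context {R : realType} {p : nat}.
Implicit Types (gamma u : 'rV[R]_p) (h : R).

(** The kernel at bandwidth [h] without its normalizing constant, which cancels in the estimator. *)
Definition exp_weight h gamma u := expR (- norm2 (h^-1 *: (gamma - u))).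

Lemma exp_weight_ge0 h gamma u : 0 <= exp_weight h gamma u.
Proof. exact: expR_ge0. Qed.

Lemma exp_weight_gt0 h gamma u : 0 < exp_weight h gamma u.
Proof. exact: expR_gt0. Qed.

Lemma exp_weight_le1 h gamma u : exp_weight h gamma u <= 1.
Proof. by rewrite -expR0 ler_expR oppr_le0 norm2_ge0. Qed.

Lemma measurable_exp_weight h gamma : measurable_fun setT (exp_weight h gamma).
Proof.
apply: (measurableT_comp (@measurable_expR R)).
apply: measurableT_comp => //; apply: (measurableT_comp (@measurable_norm2 R p)).
apply: measurable_fun_mxP => i j; under eq_fun do rewrite !mxE.
apply: measurable_funM => //; apply: measurable_funB => //.
exact: measurable_entry.
Qed.

Lemma exp_weight_off_ball (r : R) h gamma u : 0 < r -> 0 < h ->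
  ~ ball gamma r u -> exp_weight h gamma u <= expR (- (r / h)).
Proof.
move=> r0 h0; rewrite ball_rVE// => /existsNP[i /negP].
rewrite -leNgt => ri; rewrite ler_expR lerN2 (le_trans _ (ler_coord_norm2 _ i))//.
by rewrite !mxE normrM gtr0_norm ?invr_gt0// mulrC ler_pM2l ?invr_gt0.
Qed.

Lemma exp_weight_ball h gamma u : 0 < h -> ball gamma h u ->
  expR (- p%:R) <= exp_weight h gamma u.
Proof.
move=> h0; rewrite ball_rVE// => gu; rewrite ler_expR lerN2 -[leRHS]mulr1.
apply: norm2_le_coord => // i; rewrite !mxE normrM gtr0_norm ?invr_gt0//.
by rewrite mulrC ler_pdivrMr// mul1r ltW//; exact: gu.
Qed.

End exp_weight.

(** Here [k] and [kphi] are the means of the weight and of weight times loss, [s] the density error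
    and [t] the tail. Bounding [c * k] from above and [eps * k] from below cancels the terms
    [c * m * I] and leaves the drift [- eps * m * I]. *)
Lemma deviation_mean_le (R : realType) (I c eps m s t k kphi : R) :
  0 <= c -> c <= 1 -> 0 <= eps -> 0 <= I -> 0 <= s -> 0 <= t ->
  I * (m - s) <= k -> k <= I * (m + s) + t -> I * (c * m - s) <= kphi ->
  (c - eps) * k - kphi <= I * ((2 + eps) * s - eps * m) + t.
Proof.
move=> c0 c1 eps0 I0 s0 t0 klo kup kphilo.
have s0' : 0 <= I * s by rewrite mulr_ge0.
have h1 : c * k <= c * (I * (m + s) + t) by rewrite ler_wpM2l.
have h2 : eps * (I * (m - s)) <= eps * k by rewrite ler_wpM2l.
have h3 : c * t <= t by rewrite ler_piMl.
have h4 : c * (I * s) <= I * s by rewrite ler_piMl.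
lra.
Qed.

(** The mean enters squared and the second moment once, so the ratio is at most
    [B / (n * k ^+ 2 * I)]; then [A * x <= I] reduces everything to the size of [n * x]. *)
Lemma chebyshev_ratio_le (R : realType) (I a b n x k A B delta : R) :
  0 < I -> 0 < k -> a <= - (k * I) -> b <= B * I -> 0 < delta ->
  A * x <= I -> 0 < A -> B / (k ^+ 2 * A * delta) <= n * x -> 0 < n ->
  b / (n * a ^+ 2) <= delta.
Proof.
move=> I0 k0 akI bBI d0 AxI A0 Bn n0.
have kI0 : 0 < k * I by rewrite mulr_gt0.
have aneg : a < 0 by rewrite (le_lt_trans akI)// oppr_lt0.
have a2 : (k * I) ^+ 2 <= a ^+ 2.
  rewrite -[leRHS]sqrrN lerXn2r ?nnegrE ?oppr_ge0 ?(ltW kI0) ?(ltW aneg)//.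
  by rewrite lerNr.
have den0 : 0 < k ^+ 2 * A * delta by rewrite !mulr_gt0 ?exprn_gt0.
rewrite ler_pdivrMr; last by rewrite mulr_gt0// exprn_even_gt0//= lt_eqF.
apply: (le_trans bBI); apply: (@le_trans _ _ (delta * (n * (k * I) ^+ 2))); last first.
  by rewrite ler_pM2l// ler_pM2l.
rewrite ler_pdivrMr// in Bn.
apply: (@le_trans _ _ (n * x * (k ^+ 2 * A * delta) * I)); first by rewrite ler_pM2r.
have -> : n * x * (k ^+ 2 * A * delta) * I = n * k ^+ 2 * delta * I * (A * x) by ring.
have -> : delta * (n * (k * I) ^+ 2) = n * k ^+ 2 * delta * I * I by ring.
by rewrite ler_pM2l// !mulr_gt0 ?exprn_gt0.
Qed.

(** With [x = eps * m], the density error and the tail each consume at most a quarter of the drift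
    [x * I], so half of it is left. *)
Lemma deviation_mean_lt (R : realType) (I s t x a : R) : 0 <= I ->
  s <= x / 4 -> t <= x / 4 * I -> a <= I * (s - x) + t -> a <= - (x / 2 * I).
Proof.
move=> I0 sx tx /le_trans; apply.
have Is : I * s <= I * (x / 4) by rewrite ler_wpM2l.
lra.
Qed.

Lemma deviation_variance_le (R : realType) (I s t m eps : R) :
  0 <= I -> 0 <= s -> 0 <= m -> 0 <= eps ->
  (2 + eps) * s <= eps * m / 4 -> t <= eps * m / 4 * I ->
  I * (m + s) + t <= 2 * m * (1 + eps) * I.
Proof.
move=> I0 s0 m0 eps0 sm tm.
have es : 0 <= eps * s by rewrite mulr_ge0.
have Im : 0 <= I * m by rewrite mulr_ge0.
have Iem : 0 <= I * (eps * m) by rewrite !mulr_ge0.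
have Is : I * s <= I * (eps * m / 8) by rewrite ler_wpM2l//; lra.
lra.
Qed.

(** * Consistency of the estimator for one loss function *)

Section consistency.
Context {R : realType} {p q : nat} {d : measure_display} {T : measurableType d}.
Variables (P : probability T R) (Z0 : {RV P >-> ('rV[R]_p * 'rV[R]_q)%type}).
Variable Z : nat -> {RV P >-> ('rV[R]_p * 'rV[R]_q)%type}.
Variable f : 'rV[R]_p * 'rV[R]_q -> R.
Hypothesis fZ0 : joint_density Z0 f.
Hypothesis iidZ : iid_copies Z0 Z.
Hypothesis cf : continuous f.
Let Xi := support_of P (fun w => (Z0 w).2).
Hypothesis cXi : compact Xi.
Variables (gamma : 'rV[R]_p) (h : nat -> R).
Hypothesis m0 : marginal f gamma != 0.
Hypothesis h0 : forall n, 0 < h n.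
Hypothesis hcvg : h n @[n --> \oo] --> (0 : R).
Hypothesis nhcvg : (n%:R * h n ^+ p) @[n --> \oo] --> +oo.
Variables (phi : 'rV[R]_q -> R) (c eps : R).
Hypothesis mphi : measurable_fun setT phi.
Hypothesis phi01 : forall xi, 0 <= phi xi <= 1.
Hypothesis c01 : 0 <= c <= 1.
Hypothesis eps0 : 0 < eps.
Hypothesis phiE :
  \int[lebesgue_rV q]_xi (phi xi * f (gamma, xi)) = c * marginal f gamma.

Let m := marginal f gamma.
Let mgt0 : 0 < m. Proof. exact: (marginal_gt0 fZ0 m0). Qed.
Let mu := distribution P Z0.
Let V := fine (lebesgue_rV q Xi).
Let V0 : 0 <= V. Proof. exact: fine_ge0. Qed.

(** Over a non-empty sample these add up to a positive number exactly when the estimator falls below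
    [c - eps]. *)
Let dev (b : R) (z : 'rV[R]_p * 'rV[R]_q) :=
  exp_weight b gamma z.1 * (c - eps - phi z.2).

Let phi_dev xi : `|c - eps - phi xi| <= 1 + eps.
Proof.
have /andP[? ?] := phi01 xi; have /andP[? ?] := c01.
by rewrite ler_norml; apply/andP; split; move: eps0; lra.
Qed.

Let bk b : bounded_measurable (fun z : 'rV[R]_p * 'rV[R]_q => exp_weight b gamma z.1).
Proof.
split; first by apply: measurableT_comp; [exact: measurable_exp_weight|].
by exists 1 => z; rewrite ger0_norm ?exp_weight_ge0// exp_weight_le1.
Qed.

Let bphi : bounded_measurable (fun z : 'rV[R]_p * 'rV[R]_q => phi z.2).
Proof.
split; first exact: measurableT_comp.
by exists 1 => z; have /andP[? ?] := phi01 z.2; rewrite ger0_norm.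
Qed.

Let bdev b : bounded_measurable (dev b).
Proof.
apply: bounded_measurableM => //.
split; first by apply: measurable_funB => //; case: bphi.
by exists (1 + eps) => z; exact: phi_dev.
Qed.

(* [I] is the mass of the weight on the ball of radius [r], and
   [expR (- (r / b))] bounds the weight outside of it. *)
Let moments (b r e : R) : 0 < b -> 0 < r -> 0 <= e ->
  (forall u xi, ball gamma r u -> `|f (u, xi) - f (gamma, xi)| <= e) ->
  b <= r ->
  exists I, [/\ expR (- p%:R) * (b *+ 2) ^+ p <= I,
    \int[mu]_z dev b z <= I * ((2 + eps) * (e * V) - eps * m) + expR (- (r / b)) &
    \int[mu]_z (dev b z * dev b z) <= (1 + eps) ^+ 2 *
      (I * (m + e * V) + expR (- (r / b)))].
Proof.
move=> b0 r0 e0 fe br; set t := expR (- (r / b)).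
pose kap u := exp_weight b gamma u * \1_(ball gamma r) u.
have mB := measurable_ball_rV gamma r.
have mkap : measurable_fun setT kap.
  apply: measurable_funM; [exact: measurable_exp_weight|exact: measurable_indic].
have kap01 u : 0 <= kap u <= 1.
  rewrite /kap indicE; case: (_ \in _); rewrite ?mulr1 ?mulr0 ?lexx ?ler01//.
  by rewrite exp_weight_ge0 exp_weight_le1.
have kapS u : ~ ball gamma r u -> kap u = 0.
  by move=> Nu; rewrite /kap indicE memNset ?mulr0.
have kapk u : kap u <= exp_weight b gamma u.
  by rewrite /kap indicE; case: (_ \in _); rewrite ?mulr1 ?mulr0 ?exp_weight_ge0.
have kkap u : exp_weight b gamma u <= kap u + t.
  have [gu|Ngu] := pselect (ball gamma r u).
    by rewrite /kap indicE mem_set// mulr1 lerDl expR_ge0.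
  by rewrite kapS// add0r; exact: exp_weight_off_ball.
have kapB u : ball gamma r u -> kap u = exp_weight b gamma u.
  by move=> gu; rewrite /kap indicE mem_set// mulr1.
clearbody kap.
have bkap : bounded_measurable (fun z : 'rV[R]_p * 'rV[R]_q => kap z.1).
  split; first exact: (measurableT_comp mkap measurable_fst).
  by exists 1 => z; have /andP[? ?] := kap01 z.1; rewrite ger0_norm.
pose I := \int[lebesgue_rV p]_u kap u.
have IE := local_weight_integral r0 mkap kap01 kapS.
have one01 (xi : 'rV[R]_q) : 0 <= (1 : R) <= 1 by rewrite ler01 lexx.
(* The constant function [1] gives two-sided bounds for the mean weight. The loss enters [dev] with
   a minus sign, so for it the lower bound is taken. *)
have [lo1 up1] := local_bounds fZ0 cf cXi (measurable_cst (1 : R)) one01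
  m0 r0 e0 fe mkap kap01 kapS.
have [lo2 _] := local_bounds fZ0 cf cXi mphi phi01 m0 r0 e0 fe mkap kap01 kapS.
rewrite phiE -/I -/V -/m in lo2.
have G1 : \int[lebesgue_rV q]_xi (1 * f (gamma, xi)) = m.
  by apply: eq_Rintegral => xi _; rewrite mul1r.
rewrite G1 -/I -/V in lo1 up1.
have int g : bounded_measurable g -> mu.-integrable setT (EFin \o g).
  exact: bounded_measurable_integrable.
have c1 x : bounded_measurable (fun _ : 'rV[R]_p * 'rV[R]_q => x : R).
  exact: bounded_measurable_cst.
have bkap1 := bounded_measurableM bkap (c1 1).
have bkap1t := bounded_measurableD bkap1 (c1 t).
have bkapphi := bounded_measurableM bkap bphi.
have bkphi := bounded_measurableM (bk b) bphi.
pose Ek := \int[mu]_z exp_weight b gamma z.1.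
pose Ekphi := \int[mu]_z (exp_weight b gamma z.1 * phi z.2).
have Ek_lo : I * (m - e * V) <= Ek.
  apply: (le_trans lo1); apply: le_Rintegral => //.
  - exact: int bkap1.
  - exact: int.
  - by move=> z _; rewrite mulr1.
have Ek_up : Ek <= I * (m + e * V) + t.
  apply: (@le_trans _ _ (\int[mu]_z (kap z.1 * 1 + t))).
    apply: le_Rintegral => //.
    - exact: int.
    - exact: int bkap1t.
    - by move=> z _; rewrite mulr1.
  rewrite RintegralD//; [|exact: int bkap1|exact: int].
  rewrite Rintegral_cst//= probability_setT/= mulr1 lerD2r.
  exact: up1.
have Ekphi_lo : I * (c * m - e * V) <= Ekphi.
  apply: (le_trans lo2); apply: le_Rintegral => //.
  - exact: int bkapphi.
  - exact: int bkphi.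
  - by move=> z _; rewrite ler_wpM2r//; case/andP: (phi01 z.2).
(* On the cube of radius [b <= r], of volume [(b *+ 2) ^+ p], the rescaled coordinates are below
   [1], so the norm is at most [p]. *)
have I_lo : expR (- p%:R) * (b *+ 2) ^+ p <= I.
  rewrite -lee_fin /I -IE EFinM -(lebesgue_ball_rV gamma b0).
  have mb := measurable_ball_rV gamma b.
  rewrite -integral_cst//.
  apply: (@le_trans _ _ (\int[lebesgue_rV p]_(u in ball gamma b) (kap u)%:E)%E).
    apply: ge0_le_integral => //.
    - by move=> u _; rewrite lee_fin expR_ge0.
    - by apply/measurable_EFinP; exact: measurable_funTS.
    - move=> u bu; rewrite lee_fin kapB; last exact: le_ball br _ bu.
      exact: exp_weight_ball.
  apply: ge0_subset_integral => //; first exact/measurable_EFinP.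
  by move=> u _; rewrite lee_fin; case/andP: (kap01 u).
exists I; split=> //.
- have -> : \int[mu]_z dev b z = (c - eps) * Ek - Ekphi.
    rewrite -RintegralZl//; last exact: int.
    rewrite -RintegralB//; last exact: int bkphi.
      by apply: eq_Rintegral => z _; rewrite /dev; ring.
    exact: int (bounded_measurableM (c1 _) (bk b)).
  have /andP[cge0 cle1] := c01.
  apply: deviation_mean_le => //.
  - exact: ltW.
  - by apply: Rintegral_ge0 => u _; case/andP: (kap01 u).
  - by rewrite mulr_ge0.
  - exact: expR_ge0.
- apply: (@le_trans _ _ (\int[mu]_z ((1 + eps) ^+ 2 * exp_weight b gamma z.1))).
    apply: le_Rintegral => //.
    - exact: int (bounded_measurableM (bdev b) (bdev b)).
    - exact: int (bounded_measurableM (c1 _) (bk b)).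
    (* A weight in [[0, 1]] dominates its own square, so the second moment is of the order of the
       mean weight. *)
    - move=> z _; rewrite /dev mulrACA mulrC.
      apply: ler_pM; rewrite -?expr2 ?sqr_ge0//.
        rewrite -real_normK ?num_real// lerXn2r ?nnegrE//.
        by rewrite addr_ge0// ltW.
      by rewrite expr2 ler_piMl ?exp_weight_ge0 ?exp_weight_le1.
  rewrite RintegralZl//; last exact: int.
  by rewrite ler_wpM2l// sqr_ge0.
Qed.

Lemma kernel_deviation_near (delta : R) : 0 < delta ->
  \forall n \near \oo, (P [set w | (0 < \sum_(i < n)
    exp_weight (h n) gamma (Z i w).1 * (c - eps - phi (Z i w).2))%R]
    <= delta%:E)%E.
Proof.
move=> d0; have eps2 : 0 < 2 + eps by rewrite addr_gt0.
have epsm0 : 0 < eps * m by rewrite mulr_gt0.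
have V1 : 0 < V + 1 by rewrite ltr_wpDl.
(* Chosen so that the density error takes a quarter of [eps * m]; [V + 1] keeps the divisor positive
   when the support has volume [0]. *)
pose e := eps * m / (4 * (2 + eps) * (V + 1)).
have e0 : 0 < e by rewrite divr_gt0// !mulr_gt0.
have eV : (2 + eps) * (e * V) <= eps * m / 4.
  have -> : (2 + eps) * (e * V) = eps * m / 4 * (V / (V + 1)).
    by rewrite /e; field; rewrite !gt_eqF.
  rewrite ler_piMr ?divr_ge0 ?(ltW epsm0)//.
  by rewrite ler_pdivrMr// mul1r lerDl.
have [r r0 fe] := density_unif_continuous fZ0 cf cXi gamma e0.
pose A : R := expR (- p%:R) * 2 ^+ p.
have A0 : 0 < A by rewrite mulr_gt0 ?expR_gt0 ?exprn_gt0.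
(* The tail weight is at most [K * h n * h n ^+ p]. The spare factor [h n] makes it small against
   [A * h n ^+ p], a lower bound for the mass [I]. *)
pose K := (p.+1%:R / r) ^+ p.+1.
have K0 : 0 < K by rewrite exprn_gt0 ?divr_gt0.
pose k := eps * m / 2.
have k0 : 0 < k by rewrite divr_gt0.
pose B := (1 + eps) ^+ 2 * (2 * m * (1 + eps)).
have hK : 0 < eps * m / 4 * A / K by rewrite divr_gt0// mulr_gt0 ?divr_gt0.
near=> n.
have n0 : (0 < n)%N by near: n; exact: nbhs_infty_gt.
have hr : h n <= r by near: n; exact: (cvgr_le _ hcvg).
have hKn : h n <= eps * m / 4 * A / K by near: n; exact: (cvgr_le _ hcvg).
have hB : B / (k ^+ 2 * A * delta) <= n%:R * h n ^+ p.
  by near: n; move/cvgryPge : nhcvg; exact.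
have [I [I_lo a_le b_le]] := moments (h0 n) r0 (ltW e0) fe hr.
have hp0 : 0 < h n ^+ p by rewrite exprn_gt0.
have AI : A * h n ^+ p <= I.
  by move: I_lo; rewrite -[h n *+ 2]mulr_natl exprMn mulrA.
have I0 : 0 < I by rewrite (lt_le_trans _ AI)// mulr_gt0.
set t := expR (- (r / h n)) in a_le b_le.
have tI : t <= eps * m / 4 * I.
  have rh0 : 0 < r / h n by rewrite divr_gt0.
  apply: (le_trans (expRN_le_pow p rh0)).
  have -> : (p.+1%:R / (r / h n)) ^+ p.+1 = K * h n * h n ^+ p.
    rewrite /K -mulrA -exprS -exprMn; congr (_ ^+ _).
    by field; rewrite !gt_eqF.
  apply: (@le_trans _ _ (eps * m / 4 * A * h n ^+ p)).
    by rewrite ler_pM2r// mulrC -ler_pdivlMr.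
  by rewrite -mulrA ler_pM2l// divr_gt0.
have akI := deviation_mean_lt (ltW I0) eV tI a_le.
have eV0 : 0 <= e * V by rewrite mulr_ge0// ltW.
have bBI : \int[mu]_z (dev (h n) z * dev (h n) z) <= B * I.
  apply: (le_trans b_le); rewrite /B -mulrA ler_wpM2l ?sqr_ge0//.
  by apply: deviation_variance_le => //; exact: ltW.
apply: (le_trans (sum_gt0_probability (Y := fun i w => dev (h n) (Z i w))
  (a := \int[mu]_z dev (h n) z) (b := \int[mu]_z (dev (h n) z * dev (h n) z)) (n := n) _ _ _ _ _ n0)).
- by move=> i; apply: bounded_measurable_comp.
- by move=> i; exact: (iid_Rintegral iidZ).
- move=> i; rewrite (iid_Rintegral iidZ i (F := fun z => dev (h n) z * dev (h n) z))//.
  exact: bounded_measurableM.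
- by move=> i j ij; exact: (iid_RintegralM iidZ).
- by rewrite (le_lt_trans akI)// oppr_lt0 mulr_gt0.
rewrite lee_fin.
apply: (@chebyshev_ratio_le _ I _ _ _ (h n ^+ p) k A B); rewrite ?ltr0n//.
Unshelve. all: end_near.
Qed.

End consistency.

(** * The estimator and the conditional expectation *)

Section events.
Context {R : realType} {d : measure_display} {T : measurableType d}.
Variable P : probability T R.

Lemma with_probability_at_leastS (a : R) (E E' : set T) : E `<=` E' ->
  with_probability_at_least P a E -> with_probability_at_least P a E'.
Proof.
by move=> EE' [A [mA PA AE]]; exists A; split=> //; exact: subset_trans EE'.
Qed.

Lemma union_bound (I : Type) (s : seq I) (B : I -> set T) :
  (forall i, measurable (B i)) ->
  measurable (\big[setU/set0]_(i <- s) B i) /\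
  (P (\big[setU/set0]_(i <- s) B i) <= \sum_(i <- s) P (B i))%E.
Proof.
move=> mB; elim: s => [|i s [mU PU]]; first by rewrite !big_nil measure0.
rewrite !big_cons; split; first exact: measurableU.
by rewrite (le_trans (measureU2 _ _ _))// leeD2l.
Qed.

Lemma with_probability_avoid (I : choiceType) (s : seq I) (B : I -> set T)
    (delta : R) : (forall i, measurable (B i)) ->
  (\sum_(i <- s) P (B i) <= delta%:E)%E ->
  with_probability_at_least P (1 - delta)
    [set w | forall i, i \in s -> ~ B i w].
Proof.
move=> mB Bd; have [mU PU] := union_bound s mB.
exists (~` \big[setU/set0]_(i <- s) B i); split.
- exact: measurableC.
- rewrite probability_setC// EFinB leeB//; exact: le_trans PU Bd.
- move=> w Uw i si Bw; apply: Uw.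
  by rewrite -bigcup_seq; exists i.
Qed.

End events.

Section estimator.
Context {R : realType} {p q : nat}.
Variables (gammas : nat -> 'rV[R]_p) (xis : nat -> 'rV[R]_q) (n : nat) (h : R).
Variable gamma : 'rV[R]_p.
Hypothesis n0 : (0 < n)%N.

Let W := \sum_(i < n) exp_weight h gamma (gammas i).

Let W0 : 0 < W.
Proof.
rewrite /W; case: n n0 => // k _; rewrite big_ord_recl ltr_pwDl//.
  exact: exp_weight_gt0.
by apply: sumr_ge0 => i _; exact: exp_weight_ge0.
Qed.

Lemma nadaraya_watsonE phi : nadaraya_watson gammas xis n h gamma phi =
  (\sum_(i < n) exp_weight h gamma (gammas i) * phi (xis i)) / W.
Proof.
have Z0 := kernel_mass_gt0 (R := R) p.
rewrite /nadaraya_watson; under eq_bigr do rewrite kernelE -mulrA.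
rewrite -mulr_sumr -[X in _ / X]mulr_sumr -/W.
rewrite -/(exp_weight _ _ _) invfM mulrACA mulfV ?mul1r//.
by rewrite invr_eq0 gt_eqF.
Qed.

Lemma nadaraya_watson_ge0 phi : (forall i : 'I_n, 0 <= phi (xis i)) ->
  0 <= nadaraya_watson gammas xis n h gamma phi.
Proof.
move=> phi0; rewrite nadaraya_watsonE divr_ge0 ?(ltW W0)// sumr_ge0// => i _.
by rewrite mulr_ge0 ?exp_weight_ge0.
Qed.

(** The estimator is a weighted average: it is monotone and commutes with adding a constant. *)
Lemma nadaraya_watson_le phi psi (L : R) :
  (forall i : 'I_n, phi (xis i) <= psi (xis i) + L) ->
  nadaraya_watson gammas xis n h gamma phi <=
  nadaraya_watson gammas xis n h gamma psi + L.
Proof.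
move=> phipsi; rewrite !nadaraya_watsonE -[L in leRHS](mulfK (lt0r_neq0 W0)).
rewrite -mulrDl ler_pM2r ?invr_gt0// mulr_sumr -big_split/=.
apply: ler_sum => i _; rewrite [L * _]mulrC -mulrDr.
by rewrite ler_wpM2l ?exp_weight_ge0.
Qed.

Lemma nadaraya_watson_lower phi (c : R) :
  \sum_(i < n) exp_weight h gamma (gammas i) * (c - phi (xis i)) <= 0 ->
  c <= nadaraya_watson gammas xis n h gamma phi.
Proof.
move=> le0; rewrite nadaraya_watsonE ler_pdivlMr// -subr_le0 (le_trans _ le0)//.
rewrite mulr_sumr -sumrB le_eqVlt; apply/orP; left; apply/eqP.
by apply: eq_bigr => i _; ring.
Qed.

End estimator.

Section conditional_expectation.
Context {R : realType} {p q : nat} {d : measure_display} {T : measurableType d}.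
Variables (P : probability T R) (Z0 : {RV P >-> ('rV[R]_p * 'rV[R]_q)%type}).
Variable f : 'rV[R]_p * 'rV[R]_q -> R.
Hypothesis fZ0 : joint_density Z0 f.
Hypothesis cf : continuous f.
Let Xi := support_of P (fun w => (Z0 w).2).
Hypothesis cXi : compact Xi.
Variable gamma : 'rV[R]_p.
Hypothesis m0 : marginal f gamma != 0.

Let f0 z : 0 <= f z. Proof. by case: fZ0. Qed.
Let mXi : measurable Xi.
Proof. by apply: measurable_closed_rV; exact: compact_rV_closed. Qed.
Let mgt0 : 0 < marginal f gamma. Proof. exact: (marginal_gt0 fZ0 m0). Qed.

(** The loss is controlled on the support only. Its extension by zero [phi \_ Xi] is measurable and
    bounded everywhere, and has the same integral against the density, which vanishes off the
    support. *)
Definition loss_like (phi : 'rV[R]_q -> R) :=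
  measurable_fun Xi phi /\ forall xi, Xi xi -> 0 <= phi xi <= 1.

Lemma loss_like_patch phi : loss_like phi ->
  measurable_fun setT (phi \_ Xi) /\ forall xi, 0 <= (phi \_ Xi) xi <= 1.
Proof.
move=> [mphi phi01]; split; first exact: (measurable_restrictT phi mXi).1 mphi.
move=> xi; rewrite patchE; case: ifPn => [/set_mem|_]; first exact: phi01.
by rewrite lexx ler01.
Qed.

Let integrable_section phi : loss_like phi ->
  (lebesgue_rV q).-integrable setT
    (EFin \o (fun xi => (phi \_ Xi) xi * f (gamma, xi))).
Proof.
move=> /loss_like_patch[mphi phi01]; apply/integrableP; split.
  apply/measurable_EFinP; apply: measurable_funM => //.
  by apply: (measurableT_comp _ (measurable_pair1 gamma)); case: fZ0.
under eq_integral => xi _.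
  rewrite gee0_abs; last by rewrite lee_fin mulr_ge0//; case/andP: (phi01 xi).
  over.
by rewrite /= (integral_section fZ0 mphi phi01 m0) ltry.
Qed.

Lemma cond_expectationE phi : loss_like phi ->
  \int[lebesgue_rV q]_xi ((phi \_ Xi) xi * f (gamma, xi)) =
  cond_expectation f gamma phi * marginal f gamma.
Proof.
move=> phil; have -> : cond_expectation f gamma phi = (marginal f gamma)^-1 *
    \int[lebesgue_rV q]_xi ((phi \_ Xi) xi * f (gamma, xi)).
  rewrite -RintegralZl//; last exact: integrable_section.
  apply: eq_Rintegral => xi _; rewrite patchE.
  case: ifPn => [_|/negP NXi]; first by ring.
  rewrite (density_off_support fZ0 cf cXi); first by rewrite !mul0r !mulr0.
  by move=> Xixi; apply: NXi; rewrite inE.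
by rewrite mulrAC mulVf ?mul1r.
Qed.

Lemma cond_expectation_ge0_le1 phi : loss_like phi ->
  0 <= cond_expectation f gamma phi <= 1.
Proof.
move=> phil; have [mphi phi01] := loss_like_patch phil.
apply/andP; split; rewrite -(ler_pM2r mgt0) -cond_expectationE// ?mul0r ?mul1r.
  by apply: Rintegral_ge0 => xi _; rewrite mulr_ge0//; case/andP: (phi01 xi).
rewrite -lee_fin -(integral_section fZ0 mphi phi01 m0) -(marginalE fZ0 m0).
apply: ge0_le_integral => //.
- by move=> xi _; rewrite lee_fin mulr_ge0//; case/andP: (phi01 xi).
- by have /integrableP[] := integrable_section phil.
- apply/measurable_EFinP.
  by apply: (measurableT_comp _ (measurable_pair1 gamma)); case: fZ0.
- by move=> xi _; rewrite lee_fin ler_piMl//; case/andP: (phi01 xi).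
Qed.

Lemma cond_expectation_le phi psi (L : R) : loss_like phi -> loss_like psi ->
  (forall xi, Xi xi -> phi xi <= psi xi + L) ->
  cond_expectation f gamma phi <= cond_expectation f gamma psi + L.
Proof.
move=> phil psil phipsi; rewrite -(ler_pM2r mgt0) mulrDl -!cond_expectationE//.
have mfg : measurable_fun setT (fun xi => f (gamma, xi)).
  by apply: (measurableT_comp _ (measurable_pair1 gamma)); case: fZ0.
have ig : (lebesgue_rV q).-integrable setT (EFin \o (fun xi => f (gamma, xi))).
  apply/integrableP; split; first exact/measurable_EFinP.
  under eq_integral do rewrite gee0_abs ?lee_fin//.
  by rewrite /= (marginalE fZ0 m0) ltry.
have iL : (lebesgue_rV q).-integrable setT
    (EFin \o (fun xi => L * f (gamma, xi))).
  exact: (integrableZl measurableT L ig).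
have -> : L * marginal f gamma = \int[lebesgue_rV q]_xi (L * f (gamma, xi)).
  by rewrite RintegralZl.
rewrite -RintegralD//; [|exact: integrable_section..].
apply: le_Rintegral => //; first exact: integrable_section.
  exact: (integrableD measurableT (integrable_section psil) iL).
move=> xi _; rewrite !patchE; case: ifPn => [/set_mem Xixi|/negP NXi].
  by rewrite -mulrDl ler_wpM2r// phipsi.
rewrite (density_off_support fZ0 cf cXi) ?mulr0 ?addr0//.
by move=> Xixi; apply: NXi; rewrite inE.
Qed.

End conditional_expectation.

(** * Consistency uniformly over the feasible set *)

Section uniform_consistency.
Context {R : realType} {d p q : nat} {disp : measure_display}
  {T : measurableType disp}.
Variables (P : probability T R) (Z0 : {RV P >-> ('rV[R]_p * 'rV[R]_q)%type}).
Variable Z : nat -> {RV P >-> ('rV[R]_p * 'rV[R]_q)%type}.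
Variable f : 'rV[R]_p * 'rV[R]_q -> R.
Hypothesis fZ0 : joint_density Z0 f.
Hypothesis iidZ : iid_copies Z0 Z.
Hypothesis cf : continuous f.
Let Xi := support_of P (fun w => (Z0 w).2).
Hypothesis cXi : compact Xi.
Variables (gamma : 'rV[R]_p) (h : nat -> R).
Hypothesis m0 : marginal f gamma != 0.
Hypothesis h0 : forall n, 0 < h n.
Hypothesis hcvg : h n @[n --> \oo] --> (0 : R).
Hypothesis nhcvg : (n%:R * h n ^+ p) @[n --> \oo] --> +oo.
Variables (X : set 'rV[R]_d) (loss : 'rV[R]_d -> 'rV[R]_q -> R) (M : R).
Hypothesis bX : bounded_set X.
Hypothesis M0 : 0 < M.
Hypothesis lossX : forall x, X x -> loss_like Z0 (loss x).
Hypothesis lossL : forall x x' xi, X x -> X x' -> Xi xi ->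
  `|loss x xi - loss x' xi| <= M * norm2 (x - x').

Let mXi : measurable Xi.
Proof. by apply: measurable_closed_rV; exact: compact_rV_closed. Qed.

Let off i := [set w | ~ Xi (Z i w).2].

Let m_off i : measurable (off i).
Proof.
have m2 : measurable_fun setT (fun w => (Z i w).2).
  by apply: (measurableT_comp measurable_snd); exact: measurable_funPT.
rewrite (_ : off i = (fun w => (Z i w).2) @^-1` (~` Xi))//.
by rewrite -[X in measurable X]setTI; apply: m2 => //; exact: measurableC.
Qed.

(** Each [Z i] has the law of [Z0], whose second component lies in its support almost surely. *)
Let P_off i : P (off i) = 0%E.
Proof.
have mA : measurable (setT `*` ~` Xi : set ('rV[R]_p * 'rV[R]_q)).
  by apply: measurableX => //; exact: measurableC.
transitivity (distribution P (Z i) (setT `*` ~` Xi)).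
  by congr (P _); apply/seteqP; split=> w //= -[].
rewrite iidZ.1//; apply: (measure_negligible (mu := P)).
  by rewrite -[X in measurable X]setTI; exact: measurable_funPT.
have := support_of_full P (measurableT_comp measurable_snd (measurable_funPT Z0)).
by apply: negligibleS => w [].
Qed.

Lemma samples_in_support (delta : R) n : 0 <= delta ->
  with_probability_at_least P (1 - delta)
    [set w | forall i : 'I_n, Xi (Z i w).2].
Proof.
move=> d0; apply: with_probability_at_leastS (with_probability_avoid
  (s := iota 0 n) (delta := delta) m_off _); last first.
  by rewrite big1 ?lee_fin.
move=> w good i; apply: contrapT; apply: good.
by rewrite mem_iota add0n leq0n ltn_ord.
Qed.

Lemma uniform_consistency (eta delta : R) : 0 < eta -> 0 < delta ->
  \forall n \near \oo, with_probability_at_least P (1 - delta)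
    [set w | forall x, X x -> cond_expectation f gamma (loss x) <=
      nadaraya_watson (fun i => (Z i w).1) (fun i => (Z i w).2)
        n (h n) gamma (loss x) + M * eta].
Proof.
move=> eta0 d0; have eta30 : 0 < eta / 3 by rewrite divr_gt0.
have [N [NX XN] _] := eta_net_grid bX eta30.
pose eps := M * eta / 3.
have eps0 : 0 < eps by rewrite divr_gt0// mulr_gt0.
(* The value [set0] off [X] and the extension by zero of the loss make this event measurable for
   every [x], as the union bound requires. *)
pose bad n x : set T := if x \in X then [set w | (0 < \sum_(i < n)
  exp_weight (h n) gamma (Z i w).1 * (cond_expectation f gamma (loss x) - eps -
    (loss x \_ Xi) (Z i w).2))%R] else set0.
have m_bad n x : measurable (bad n x).
  rewrite /bad; case: ifPn => // /set_mem Xx.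
  have [mphi _] := loss_like_patch cXi (lossX Xx).
  rewrite -[X in measurable X]setTI; apply: measurable_fun_ltr => //.
  apply: measurable_sum => i; apply: measurable_funM.
    apply: (measurableT_comp (measurable_exp_weight _ _)).
    by apply: (measurableT_comp measurable_fst); exact: measurable_funPT.
  apply: measurable_funB => //; apply: (measurableT_comp mphi).
  by apply: (measurableT_comp measurable_snd); exact: measurable_funPT.
(* An equal share of [delta] for each net point; the successor avoids dividing by zero for an empty
   net. *)
pose delta' := delta / (#|` N|.+1)%:R.
have P_bad : \forall n \near \oo, forall x, x \in N -> (P (bad n x) <= delta'%:E)%E.
  have d'0 : 0 < delta' by rewrite divr_gt0.
  have near_bad x : x \in N -> \forall n \near \oo, (P (bad n x) <= delta'%:E)%E.
    move=> Nx; have Xx : X x by exact: NX.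
    have [mphi phi01] := loss_like_patch cXi (lossX Xx).
    have c01 := cond_expectation_ge0_le1 fZ0 cf cXi m0 (lossX Xx).
    have phiE := cond_expectationE fZ0 cf cXi m0 (lossX Xx).
    have := kernel_deviation_near fZ0 iidZ cf cXi m0 h0 hcvg nhcvg mphi phi01
      c01 eps0 phiE d'0.
    by apply: filterS => n; rewrite /bad mem_set.
  have all_bad : \oo (\bigcap_(x in [set` N]) [set n | (P (bad n x) <= delta'%:E)%E]).
    exact: filter_bigI.
  by near=> n; near: n; apply: filterS all_bad => n Nn x Nx; exact: Nn.
near=> n.
have n0 : (0 < n)%N by near: n; exact: nbhs_infty_gt.
have Pn : forall x, x \in N -> (P (bad n x) <= delta'%:E)%E by near: n.
(* A single union bound excludes both samples off the support, at no cost, and deviations at net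
   points. *)
pose B (k : nat + 'rV[R]_d) := match k with inl i => off i | inr x => bad n x end.
pose s := [seq inl i | i <- iota 0 n] ++ [seq inr x | x <- N].
have mB k : measurable (B k) by case: k => [i|x]; [exact: m_off|exact: m_bad].
apply: with_probability_at_leastS (with_probability_avoid
  (s := s) (delta := delta) mB _); last first.
  rewrite big_cat/= !big_map big1 ?add0r//; last by move=> i _; exact: P_off.
  apply: (@le_trans _ _ (\sum_(x <- N) delta'%:E)%E).
    by rewrite big_seq [leRHS]big_seq; apply: lee_sum => x; exact: Pn.
  rewrite sumEFin big_const_seq count_predT iter_addr_0 lee_fin /delta'.
  by rewrite -[leLHS]mulr_natr -mulrA ler_piMr ?(ltW d0)// mulrC ler_pdivrMr// mul1r ler_nat.
move=> w good x Xx; have [x' Nx' xx'] := XN _ Xx.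
have Xx' := NX _ Nx'.
have wXi (i : 'I_n) : Xi (Z i w).2.
  apply: contrapT; apply: (good (inl (i : nat))).
  by rewrite mem_cat map_f// mem_iota add0n leq0n ltn_ord.
have L0 : M * norm2 (x - x') <= M * (eta / 3) by rewrite ler_pM2l.
have lossD xi : Xi xi -> `|loss x xi - loss x' xi| <= M * (eta / 3).
  by move=> Xixi; exact: le_trans (lossL Xx Xx' Xixi) L0.
have e1 : cond_expectation f gamma (loss x) <=
    cond_expectation f gamma (loss x') + M * (eta / 3).
  apply: (cond_expectation_le fZ0 cf cXi m0 (lossX Xx) (lossX Xx')) => xi /lossD.
  by rewrite ler_distl => /andP[].
have e2 : nadaraya_watson (fun i => (Z i w).1) (fun i => (Z i w).2) n (h n) gamma (loss x') <=
  nadaraya_watson (fun i => (Z i w).1) (fun i => (Z i w).2) n (h n) gamma (loss x) + M * (eta / 3).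
  apply: nadaraya_watson_le => // i; have := lossD _ (wXi i).
  by rewrite distrC ler_distl => /andP[].
have e3 : cond_expectation f gamma (loss x') - eps <=
  nadaraya_watson (fun i => (Z i w).1) (fun i => (Z i w).2) n (h n) gamma (loss x').
  apply: nadaraya_watson_lower => //; rewrite leNgt; apply/negP => gt0.
  apply: (good (inr x')); first by rewrite mem_cat orbC map_f.
  rewrite /= /bad mem_set//=.
  by under eq_bigr => i _ do rewrite patchE (mem_set (wXi i)).
(* The three thirds pay for moving the expectation from [x] to [x'], for the deviation at [x'], and
   for moving the estimator back to [x]. *)
have -> : M * eta = M * (eta / 3) + eps + M * (eta / 3) by rewrite /eps; field.
rewrite addrA (le_trans e1)// lerD2r addrA -lerBlDr.
exact: le_trans e3 e2.
Unshelve. all: end_near.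
Qed.
End uniform_consistency.

(** * The net and the bound for every positive sample size *)

Theorem theorem3 (R : realType) (d : nat) :
  exists2 C : R, 0 < C &
  forall (p q : nat)
    (disp : measure_display) (T : measurableType disp) (P : probability T R)
    (Z0 : {RV P >-> ('rV[R]_p * 'rV[R]_q)%type})
    (Z : nat -> {RV P >-> ('rV[R]_p * 'rV[R]_q)%type})
    (f : 'rV[R]_p * 'rV[R]_q -> R)
    (gamma : 'rV[R]_p)
    (X : set 'rV[R]_d) (loss : 'rV[R]_d -> 'rV[R]_q -> R)
    (h : nat -> R) (M eta delta : R),
  let Xi := support_of P (fun w => (Z0 w).2) in
  joint_density Z0 f ->
  iid_copies Z0 Z ->
  (forall x, X x -> measurable_fun Xi (loss x)) ->
  compact Xi ->
  (forall x xi, X x -> Xi xi -> 0 <= loss x xi <= 1) ->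
  twice_diff_bounded f ->
  marginal f gamma != 0 ->
  (forall n, 0 < h n) ->
  h n @[n --> \oo] --> (0 : R) ->
  (n%:R * h n ^+ p) @[n --> \oo] --> +oo ->
  bounded_set X ->
  0 < M ->
  (forall x x' xi, X x -> X x' -> Xi xi ->
    `|loss x xi - loss x' xi| <= M * norm2 (x - x')) ->
  0 < eta ->
  0 < delta < 1 ->
  (eta <= diameter X ->
    exists2 N : {fset 'rV[R]_d}, eta_net X eta N &
      (#|` N|)%:R <= C * (diameter X / eta) ^+ d) /\
  (forall N : {fset 'rV[R]_d}, eta_net X eta N ->
    exists2 o1 : nat -> R, o1 n @[n --> \oo] --> (0 : R) &
    forall n, (0 < n)%N ->
      0 < 1 + o1 n /\
      let L := ln ((#|` N|)%:R / delta) in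
      let r := n%:R * h n ^+ p * scaled_marginal f gamma * (1 + o1 n) in
      with_probability_at_least P (1 - delta)
        [set w | forall x, X x ->
          cond_expectation f gamma (loss x) <=
            nadaraya_watson (fun i => (Z i w).1) (fun i => (Z i w).2)
              n (h n) gamma (loss x)
            + Num.sqrt (cond_variance f gamma (loss x) / r * L)
            + M * eta * (1 + Num.sqrt (L / r))]).
Proof.
exists ((2 * d.+1%:R + 1) ^+ d).
  by rewrite exprn_gt0// ltr_wpDl// mulr_ge0.
move=> p q disp T P Z0 Z f gamma X loss h M eta delta Xi fZ0 iidZ mloss cXi
  loss01 fdiff m0 h0 hcvg nhcvg bX M0 lossL eta0 /andP[d0 d1].
have cf : continuous f by move=> z; apply: differentiable_continuous; exact: fdiff.1.
have lossX x : X x -> loss_like Z0 (loss x).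
  by move=> Xx; split; [exact: mloss|move=> xi; exact: loss01].
split; first exact: eta_net_card.
move=> N [NX XN].
(* With [X] empty the net is empty too and [L] is not positive, but the bound is vacuous. *)
have [X0|/set0P[x0 Xx0]] := eqVneq X set0.
  exists (fun=> 0); first exact: cvg_cst.
  move=> n n0; rewrite addr0; split=> //=.
  exists setT; split=> //; first by rewrite probability_setT lee_fin gerBl ltW.
  by move=> w _ x; rewrite X0.
have [n0 _ cons] := uniform_consistency fZ0 iidZ cf cXi m0 h0 hcvg nhcvg bX M0
  lossX lossL eta0 d0.
set L := ln _.
(* The net is non-empty and [delta < 1], so the argument of the logarithm exceeds [1]. Positivity of
   [L] allows it as a factor of [1 + o1 n]. *)
have L0 : 0 < L.
  apply: ln_gt0; rewrite ltr_pdivlMr// mul1r (lt_le_trans d1)// ler1n cardfs_gt0.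
  by have [x' Nx' _] := XN _ Xx0; apply/fset0Pn; exists x'.
pose s n := n%:R * h n ^+ p * scaled_marginal f gamma.
have s0 n : (0 < n)%N -> 0 < s n.
  move=> n_gt0; apply: mulr_gt0; first by rewrite mulr_gt0 ?ltr0n ?exprn_gt0.
  apply: divr_gt0; first exact: (marginal_gt0 fZ0 m0).
  by apply: mulr_gt0 => //; exact: integral_kernel_sqr_gt0.
have Meta0 : 0 < M * eta by rewrite mulr_gt0.
(* Below [n0] this makes [r = L * (M * eta) ^+ 2], hence [Num.sqrt (L / r) = (M * eta)^-1]. *)
pose o1 n : R := if (n0 <= n)%N then 0 else L * (M * eta) ^+ 2 / s n - 1.
exists o1.
  apply: cvg_near_cst; exists n0 => // n /= n0n; rewrite /o1.
  by rewrite n0n.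
move=> n n_gt0; have [n0n|nn0] := leqP n0 n.
  rewrite /o1 n0n addr0; split=> //=.
  apply: with_probability_at_leastS (cons n n0n) => w good x Xx.
  (* The consistency error is already within [M * eta]; both square roots are dropped as
     non-negative. *)
  rewrite (le_trans (good x Xx))// -addrA lerD2l.
  rewrite (le_trans _ (ler_wpDl _ (lexx _)))// ?sqrtr_ge0//.
  by rewrite ler_peMr ?(ltW Meta0)// lerDl sqrtr_ge0.
have c0 : 1 + o1 n = L * (M * eta) ^+ 2 / s n.
  by rewrite /o1 leqNgt nn0/= addrC subrK.
split; first by rewrite c0 divr_gt0 ?s0// mulr_gt0// exprn_gt0.
rewrite /= c0 -/(s n).
have -> : s n * (L * (M * eta) ^+ 2 / s n) = L * (M * eta) ^+ 2.
  by rewrite mulrC divfK// gt_eqF// s0.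
have -> : L / (L * (M * eta) ^+ 2) = (M * eta)^-1 ^+ 2.
  by rewrite invfM mulrA divff ?gt_eqF// mul1r exprVn.
rewrite sqrtr_sqr gtr0_norm ?invr_gt0// mulrDr mulr1 divff ?gt_eqF//.
(* The last term is now [M * eta + 1], and the conditional expectation is at most [1]. The samples
   must lie in the support for the estimator to be non-negative. *)
have := samples_in_support iidZ cXi n (ltW d0).
apply: with_probability_at_leastS => w wXi x Xx.
have /andP[_ le1] := cond_expectation_ge0_le1 fZ0 cf cXi m0 (lossX x Xx).
rewrite (le_trans le1)// addrA ler_wpDl// addr_ge0 ?(ltW Meta0)//.
rewrite addr_ge0 ?sqrtr_ge0// nadaraya_watson_ge0// => i.
by case/andP: (loss01 x _ Xx (wXi i)).
Qed.
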